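(* If $\nu>-2$ and $\alpha\in[0,1)$, then the radius of convexity of order $\alpha$, $r^c_\alpha(\varphi_\nu)$, of the function $\varphi_{\nu}(z)=2^{\nu}\Gamma(\nu+1)z^{-\frac{\nu}{2}}J_{\nu}(\sqrt{z})$ is the smallest positive root of the equation $$\frac{r^{1/2}J_{\nu}(r^{1/2})}{2J_{\nu+1}(r^{1/2})}-\nu=\alpha.$$ Moreover, $r^c_{\alpha}(\varphi_{\nu})<j_{\nu+1,1}$, where $j_{\nu+1,1}$ is the first positive zero of $J_{\nu+1}$.
   Context: $J_\nu$ is the Bessel function of the first kind, $J_{\nu}(z)=\sum_{n\geq0}\frac{(-1)^{n}}{n!\,\Gamma(n+\nu+1)}\left(\frac{z}{2}\right)^{2n+\nu}$. The function $\varphi_\nu$ has the expansion $\varphi_{\nu}(z)=2^{\nu}\Gamma(\nu+1)z^{-\frac{\nu}{2}}J_{\nu}(\sqrt{z})=1-\frac{1}{4(\nu+1)}z+\dots$. The radius of convexity of order $\alpha$ of a function $f$ (not necessarily normalized) is $$r^c_\alpha(f)=\sup\left\{r\in(0,\infty)\,:\ \operatorname{Re}\left(1+\frac{zf''(z)}{f'(z)}\right)>\alpha\ \text{ for all } |z|<r\right\}.$$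
   Formalization: The printed bound r^c < j_{ν+1,1} is false (ν=-1/2, α=0 gives r^c≈4.116>π=j_{1/2,1}); proved instead is r^c < (j_{ν+1,1})^2. The value ν=-1 is excluded, since Γ(ν+1) and hence φ_ν are undefined there. *)

(* Defs.v *)
(* Stdlib reals, with Coquelicot for complex numbers, derivatives, series and
   improper integrals. *)
From Stdlib Require Import Reals Factorial.
From Coquelicot Require Import Coquelicot.
Open Scope R_scope.

Fixpoint rising (x : R) (n : nat) : R :=
  match n with
  | O => 1
  | S m => rising x m * (x + INR m)
  end.

Definition euler_integral (x : R) : R :=
  RInt_gen (fun t : R => Rpower t (x - 1) * exp (- t))
           (at_right 0) (Rbar_locally p_infty).

(* The least natural n with 0 < x + n; it is 0 when 0 < x. *)
Definition gamma_shift (x : R) : nat := Z.to_nat (up (- x)).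

(* Euler's integral, continued to x <= 0 by Gamma(x) = Gamma(x+n) / (x(x+1)...(x+n-1)).
   At the poles 0, -1, -2, ... the denominator is 0 and, since / 0 = 0 in Stdlib,
   / Gamma x = 0, the usual convention for 1 / Gamma. *)
Definition Gamma (x : R) : R :=
  euler_integral (x + INR (gamma_shift x)) / rising x (gamma_shift x).

(* Principal argument, in (-PI, PI], for z <> 0. *)
Definition Carg (z : C) : R :=
  if Rle_dec 0 (Im z) then acos (Re z / Cmod z) else - acos (Re z / Cmod z).

(* Principal branch of z^a; 0^0 = 1, and 0^a = 0 for the other a. *)
Definition Cpower (z : C) (a : R) : C :=
  if Ceq_dec z 0 then (if Req_EM_T a 0 then RtoC 1 else RtoC 0)
  else (RtoC (Rpower (Cmod z) a) * (cos (a * Carg z), sin (a * Carg z)))%C.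

Definition CSeries (a : nat -> C) : C :=
  (Series (fun n => Re (a n)), Series (fun n => Im (a n))).

Definition BesselJ (nu : R) (z : C) : C :=
  CSeries (fun n =>
    (RtoC ((-1) ^ n / (INR (fact n) * Gamma (INR n + nu + 1)))
     * Cpower (z / 2) (2 * INR n + nu))%C).

(* 2^nu Gamma(nu+1) z^(-nu/2) J_nu(z^(1/2)). With principal branches the branch
   cuts cancel; the value 1 at z = 0, where the formula is not defined, is the
   constant term of the expansion 1 - z / (4 (nu + 1)) + ... *)
Definition phi (nu : R) (z : C) : C :=
  if Ceq_dec z 0 then RtoC 1
  else (RtoC (Rpower 2 nu * Gamma (nu + 1)) * Cpower z (- nu / 2)
        * BesselJ nu (Cpower z (1 / 2)))%C.

(* The differentiability and f'(z) <> 0 clauses say that the quotient is defined;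
   C_derive and division are total functions. *)
Definition convex_of_order_in_disk (alpha : R) (f : C -> C) (r : R) : Prop :=
  forall z : C, Cmod z < r ->
    @ex_derive C_AbsRing C_NormedModule f z /\
    @ex_derive C_AbsRing C_NormedModule (C_derive f) z /\
    C_derive f z <> RtoC 0 /\
    Re (1 + z * C_derive (C_derive f) z / C_derive f z)%C > alpha.

Definition radius_of_convexity (alpha : R) (f : C -> C) : Rbar :=
  Lub_Rbar (fun r : R => 0 < r /\ convex_of_order_in_disk alpha f r).

Definition smallest_positive (P : R -> Prop) (x : R) : Prop :=
  0 < x /\ P x /\ forall y : R, 0 < y < x -> ~ P y.

(* The first clause keeps out the points where the equation is not defined. *)
Definition convexity_equation (nu alpha r : R) : Prop :=
  BesselJ (nu + 1) (RtoC (sqrt r)) <> RtoC 0 /\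
  (RtoC (sqrt r) * BesselJ nu (RtoC (sqrt r))
     / (2 * BesselJ (nu + 1) (RtoC (sqrt r))) - RtoC nu)%C = RtoC alpha.

(* Main.v *)
Require Import Defs.
From Stdlib Require Import Reals Factorial Lra Lia FunctionalExtensionality.
From Coquelicot Require Import Coquelicot.
Open Scope R_scope.

(** Put [mu = nu + 1 > -1] and [f = phi_mu]. Then [phi_nu' = - f / (4 (nu + 1))], so the
    quantity to be bounded is [1 + z f'(z) / f(z)]. By Bessel's equation the logarithmic
    derivative [h = - f' / f] solves the Riccati equation
    [x h' + (mu + 1) h = 1 / 4 + x h^2], whose recursion shows that all Taylor
    coefficients of [h] are positive (they are the Rayleigh sums of the zeros of
    [J_mu]). Comparison of [- f' / f] with the Taylor polynomials of [h] shows that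
    the series [h] converges up to the first positive zero [X] of [f], and a geometric
    lower bound on its coefficients shows that [X] exists. Hence for [|z| = s < X],
    [Re (z f'(z) / f(z)) = - Re (z h(z)) >= - s h(s) = s f'(s) / f(s)]: the infimum is
    attained on the positive axis, where the contiguity relation
    [(nu + 1) phi_nu = (nu + 1) f + x f'] turns it into the stated equation. *)

(** * The power series *)

(** The classical route writes [h] as the sum of [1 / (x_k - z)] over the zeros [x_k] of [f], which
    presupposes that all zeros are real and positive and that [f] has a Hadamard product. The
    Riccati recursion yields the positivity of the coefficients with no knowledge of the zeros. The
    price is that [h] starts as a formal series, linked to [- f' / f] only by a one-sided estimate
    on the real axis. This estimate gives convergence; only then can [f' = - h f] be proved, as an
    identity of coefficients, which carries over to the complex disk.

    That [f] has no complex zero in [|z| < X] must also come from this identity, since dividing by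
    [f] would be circular; hence a monotonicity argument along rays. The complex analysis involved
    is elementary: series summed by components and a quadratic Taylor estimate.

    The shift [mu = nu + 1] makes every divisor [n + mu + 1] of the recursion positive, also for
    [nu] between -2 and -1. *)

Fixpoint bcoef (mu : R) (n : nat) : R :=
  match n with
  | O => 1
  | S m => - bcoef mu m / (4 * (INR m + 1) * (INR m + mu + 1))
  end.

Definition entire (a : nat -> R) : Prop := CV_radius a = p_infty.

Lemma entire_disk (a : nat -> R) (x : R) : entire a -> CV_disk a x.
Proof.
  intros Ha. apply CV_disk_inside. rewrite Ha. exact I.
Qed.

Lemma entire_radius (a : nat -> R) (x : R) :
  entire a -> Rbar_lt (Rabs x) (CV_radius a).
Proof.
  intros Ha. rewrite Ha. exact I.
Qed.

Lemma CV_disk_radius (a : nat -> R) (x : R) :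
  CV_disk a x -> Rbar_le (Rabs x) (CV_radius a).
Proof.
  intros Hx. unfold CV_radius.
  destruct (Lub_Rbar_correct (CV_disk a)) as [Hub _].
  apply Hub. apply (CV_disk_le a (Rabs x) x); auto.
  rewrite Rabs_Rabsolu; lra.
Qed.

Lemma entire_derive (a : nat -> R) : entire a -> entire (PS_derive a).
Proof. unfold entire. now rewrite CV_radius_derive. Qed.

(** No divisor in [bcoef] vanishes. This is weaker than [-1 < mu] because [phi nu] itself is
    expanded for [nu] between -2 and -1 as well. *)
Definition regular (mu : R) : Prop := forall n : nat, INR n + mu + 1 <> 0.

Lemma bcoef_neq_0 (mu : R) (n : nat) :
  regular mu -> bcoef mu n <> 0.
Proof.
  intros mu_reg.
  induction n as [|n IH]; simpl; [lra|].
  pose proof (pos_INR n).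
  unfold Rdiv. apply Rmult_integral_contrapositive_currified; [lra|].
  apply Rinv_neq_0_compat. repeat apply Rmult_integral_contrapositive_currified; auto; lra.
Qed.

Lemma bcoef_S (mu : R) (n : nat) :
  regular mu ->
  (INR n + 1) * (INR n + mu + 1) * bcoef mu (S n) = - bcoef mu n / 4.
Proof.
  intros mu_reg.
  simpl. field. split; [apply mu_reg|]. pose proof (pos_INR n). lra.
Qed.

Lemma bcoef_entire (mu : R) : regular mu -> entire (bcoef mu).
Proof.
  intros mu_reg.
  apply CV_radius_infinite_DAlembert; [intros n; now apply bcoef_neq_0|].
  apply is_lim_seq_ext with (fun n => Rabs (/ (4 * (INR n + 1)) * / (INR n + (mu + 1)))).
  { intros n. pose proof (bcoef_neq_0 mu n mu_reg). pose proof (mu_reg n). pose proof (pos_INR n).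
    replace (bcoef mu (S n) / bcoef mu n)
      with (- (/ (4 * (INR n + 1)) * / (INR n + (mu + 1)))) by
      (simpl; field; repeat split; try lra).
    now rewrite Rabs_Ropp. }
  replace (Finite 0) with (Rbar_abs (0 * 0)) by (simpl; rewrite Rmult_0_l, Rabs_R0; auto).
  apply is_lim_seq_abs.
  apply is_lim_seq_mult'.
  - replace (Finite 0) with (Rbar_inv p_infty) by auto.
    apply is_lim_seq_inv; [|discriminate].
    apply is_lim_seq_le_p_loc with INR; [|apply is_lim_seq_INR].
    exists O. intros n _. pose proof (pos_INR n). lra.
  - replace (Finite 0) with (Rbar_inv p_infty) by auto.
    apply is_lim_seq_inv; [|discriminate].
    eapply is_lim_seq_plus; [apply is_lim_seq_INR|apply is_lim_seq_const|].
    reflexivity.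
Qed.

(** Bessel's equation in the variable [x = w ^ 2], once the factor [w ^ mu] is removed from
    [J_mu(w)]; on coefficients it is the recursion [bcoef_S]. *)
Lemma bessel_ode (mu x : R) :
  regular mu ->
  x * PSeries (PS_derive (PS_derive (bcoef mu))) x
  + (mu + 1) * PSeries (PS_derive (bcoef mu)) x + PSeries (bcoef mu) x / 4 = 0.
Proof.
  intros mu_reg.
  assert (E0 := bcoef_entire mu mu_reg).
  assert (E1 := entire_derive _ E0). assert (E2 := entire_derive _ E1).
  rewrite <- PSeries_incr_1.
  replace (PSeries (bcoef mu) x / 4) with (/ 4 * PSeries (bcoef mu) x) by field.
  rewrite <- !PSeries_scal.
  assert (X0 : ex_pseries (bcoef mu) x) by (apply CV_radius_inside, entire_radius; auto).
  assert (X1 : ex_pseries (PS_derive (bcoef mu)) x) by (apply CV_radius_inside, entire_radius; auto).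
  assert (X2 : ex_pseries (PS_derive (PS_derive (bcoef mu))) x) by (apply CV_radius_inside, entire_radius; auto).
  rewrite <- PSeries_plus; [|apply ex_pseries_incr_1; auto|apply ex_pseries_scal; auto; apply Rmult_comm].
  rewrite <- PSeries_plus; [|apply ex_pseries_plus; [apply ex_pseries_incr_1; auto|apply ex_pseries_scal; auto; apply Rmult_comm]|apply ex_pseries_scal; auto; apply Rmult_comm].
  rewrite (PSeries_ext _ (fun _ => 0)); [apply PSeries_const_0|].
  intros n. pose proof (bcoef_S mu n mu_reg) as HS.
  (* Index 0 is apart: the shifted series has constant term 0 by definition. *)
  destruct n as [|n].
  - change (0 + (mu + 1) * (INR 1 * bcoef mu 1) + / 4 * bcoef mu 0 = 0).
    simpl INR in *. lra.
  - change (INR (S n) * (INR (S (S n)) * bcoef mu (S (S n))) + (mu + 1) * (INR (S (S n)) * bcoef mu (S (S n))) + / 4 * bcoef mu (S n) = 0).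
    rewrite (S_INR (S n)). lra.
Qed.

(** * The Riccati equation *)

(** Each coefficient depends on all earlier ones through a convolution, so the structural recursion
    carries the table of the coefficients 0 to [n]. Beyond [n] the table repeats its last value,
    which is never read. *)
Fixpoint riccati_table (mu : R) (n : nat) : nat -> R :=
  match n with
  | O => fun _ => / (4 * (mu + 1))
  | S m => fun k =>
      if Nat.leb k m then riccati_table mu m k
      else PS_mult (riccati_table mu m) (riccati_table mu m) m / (INR (S m) + mu + 1)
  end.

(* Power series solution of [x h' + (mu + 1) h = 1 / 4 + x h^2], the equation of
   [h = - f' / f]. *)
Definition riccati (mu : R) (n : nat) : R := riccati_table mu n n.

Lemma riccati_table_eq (mu : R) (n k : nat) :
  (k <= n)%nat -> riccati_table mu n k = riccati mu k.
Proof.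
  induction n as [|n IH]; intros Hk.
  - now replace k with O by lia.
  - destruct (Nat.eq_dec k (S n)) as [->|Hn]; [reflexivity|].
    simpl. destruct (Nat.leb_spec k n); [apply IH; lia|lia].
Qed.

Lemma riccati_0 (mu : R) : riccati mu 0 = / (4 * (mu + 1)).
Proof. reflexivity. Qed.

(** The coefficient of [x ^ (n + 1)] in the Riccati equation. *)
Lemma riccati_S (mu : R) (n : nat) :
  -1 < mu -> (INR (S n) + mu + 1) * riccati mu (S n) = PS_mult (riccati mu) (riccati mu) n.
Proof.
  intros Hmu. unfold riccati at 1. cbn [riccati_table].
  destruct (Nat.leb_spec (S n) n); [lia|].
  transitivity (PS_mult (riccati_table mu n) (riccati_table mu n) n).
  { field. pose proof (pos_INR (S n)). lra. }
  apply sum_eq. intros i Hi. now rewrite !riccati_table_eq by lia.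
Qed.

Lemma sum_f_R0_pos (a : nat -> R) (n : nat) :
  (forall k, (k <= n)%nat -> 0 < a k) -> 0 < sum_f_R0 a n.
Proof.
  induction n as [|n IH]; intros Ha; simpl; [now apply Ha|].
  apply Rplus_lt_0_compat; [apply IH; intros k Hk; apply Ha; lia|apply Ha; lia].
Qed.

Lemma riccati_pos (mu : R) (n : nat) : -1 < mu -> 0 < riccati mu n.
Proof.
  intros Hmu. induction n as [n IH] using (well_founded_induction Wf_nat.lt_wf).
  destruct n as [|n].
  - rewrite riccati_0. apply Rinv_0_lt_compat. lra.
  - apply Rmult_lt_reg_l with (INR (S n) + mu + 1).
    { pose proof (pos_INR (S n)). lra. }
    rewrite Rmult_0_r, riccati_S by auto.
    apply sum_f_R0_pos. intros k Hk. apply Rmult_lt_0_compat; apply IH; lia.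
Qed.

Definition riccati_sum (mu : R) (n : nat) (x : R) : R :=
  sum_f_R0 (fun k => riccati mu k * x ^ k) n.

Definition riccati_dsum (mu : R) (n : nat) (x : R) : R :=
  sum_f_R0 (fun k => riccati mu k * (INR k * x ^ pred k)) n.

Lemma is_derive_monomial (c x : R) (n : nat) :
  is_derive (fun t => c * t ^ n) x (c * (INR n * x ^ pred n)).
Proof.
  apply (is_derive_scal (fun t => t ^ n)).
  apply is_derive_Reals, derivable_pt_lim_pow.
Qed.

Lemma is_derive_riccati_sum (mu : R) (n : nat) (x : R) :
  is_derive (riccati_sum mu n) x (riccati_dsum mu n x).
Proof.
  induction n as [|n IH].
  - apply is_derive_monomial.
  - apply (is_derive_plus (K:=R_AbsRing) (V:=R_NormedModule)); [exact IH|].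
    apply is_derive_monomial.
Qed.

Lemma riccati_sum_nonneg (mu : R) (n : nat) (x : R) :
  -1 < mu -> 0 <= x -> 0 <= riccati_sum mu n x.
Proof.
  intros Hmu Hx. apply cond_pos_sum. intros k.
  apply Rmult_le_pos; [now apply Rlt_le, riccati_pos|now apply pow_le].
Qed.

(** A partial sum solves the equation with [h ^ 2] truncated at degree [n]. The truncated square
    involves only coefficients of index at most [n], one less than on the left; this gap drives the
    induction in [riccati_sum_le_blog]. *)
Lemma riccati_sum_ode (mu : R) (n : nat) (x : R) :
  -1 < mu ->
  x * riccati_dsum mu (S n) x + (mu + 1) * riccati_sum mu (S n) x
  = / 4 + x * sum_f_R0 (fun k => PS_mult (riccati mu) (riccati mu) k * x ^ k) n.
Proof.
  intros Hmu. unfold riccati_sum, riccati_dsum.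
  induction n as [|n IH].
  - cbn [sum_f_R0]. rewrite <- (riccati_S mu 0 Hmu), riccati_0. simpl. field. lra.
  - rewrite 2!(tech5 _ (S n)), (tech5 (fun k => PS_mult _ _ k * _) n), <- (riccati_S mu (S n) Hmu).
    transitivity ((/ 4 + x * sum_f_R0 (fun k => PS_mult (riccati mu) (riccati mu) k * x ^ k) n)
      + riccati mu (S (S n)) * x ^ S (S n) * (INR (S (S n)) + mu + 1)).
    + rewrite <- IH. simpl pred. simpl pow. ring.
    + simpl pow. ring.
Qed.

(** Besides the truncated Cauchy product, the square of the partial sum contains only products of
    total degree above [n], all nonnegative. [cauchy_finite] separates them; it requires a positive
    top index, hence the case [n = 0]. *)
Lemma conv_le_square (a : nat -> R) (x : R) (n : nat) :
  (forall k, 0 <= a k) -> 0 <= x ->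
  sum_f_R0 (fun k => PS_mult a a k * x ^ k) n
  <= sum_f_R0 (fun k => a k * x ^ k) n * sum_f_R0 (fun k => a k * x ^ k) n.
Proof.
  intros Ha Hx. destruct n as [|n]; [simpl; unfold PS_mult; simpl; lra|].
  rewrite cauchy_finite by lia.
  match goal with |- ?A <= ?B + ?C => replace A with B; [assert (0 <= C); [|lra]|] end.
  - apply cond_pos_sum. intros k. apply cond_pos_sum. intros l.
    apply Rmult_le_pos; apply Rmult_le_pos; auto using pow_le.
  - apply sum_eq. intros i Hi. unfold PS_mult. rewrite Rmult_comm, scal_sum.
    apply sum_eq. intros k Hk. replace (x ^ i) with (x ^ k * x ^ (i - k)); [ring|].
    rewrite <- pow_add. f_equal. lia.
Qed.

(** The equation is singular at 0. The integrating factor [x ^ c] gives [(x ^ c E)' = x ^ (c - 1) (x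
    E' + c E) >= 0], and [x ^ c E] tends to 0 at 0. *)
Lemma ode_nonneg (E dE : R -> R) (c X : R) :
  0 < c -> E 0 = 0 -> continuous E 0 ->
  (forall x, 0 < x < X -> is_derive E x (dE x)) ->
  (forall x, 0 < x < X -> 0 <= x * dE x + c * E x) ->
  forall x, 0 < x < X -> 0 <= E x.
Proof.
  intros Hc E0 Ec HE Hode x Hx.
  destruct (Rle_lt_dec 0 (E x)) as [|Hneg]; auto. exfalso.
  set (d := - (Rpower x c * E x)).
  assert (Hd : 0 < d).
  { unfold d. assert (0 < Rpower x c) by apply exp_pos. nra. }
  destruct (Ec (fun y => Rabs (y - E 0) < d)) as [eps Heps].
  { exists (mkposreal d Hd). intros y Hy. exact Hy. }
  (* The three bounds give [y < x], [|E y| < d] and [y ^ c <= 1]. Then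
     [y ^ c * E y > - d = x ^ c * E x], against monotonicity. *)
  set (y := Rmin (Rmin (x / 2) (eps / 2)) 1).
  assert (Hy : 0 < y /\ y <= x / 2 /\ y <= eps / 2 /\ y <= 1).
  { destruct eps as [e He]; simpl in *. unfold y.
    pose proof (Rmin_l (Rmin (x / 2) (e / 2)) 1). pose proof (Rmin_r (Rmin (x / 2) (e / 2)) 1).
    pose proof (Rmin_l (x / 2) (e / 2)). pose proof (Rmin_r (x / 2) (e / 2)).
    repeat split; try lra. repeat apply Rmin_glb_lt; lra. }
  assert (HEy : Rabs (E y - E 0) < d).
  { apply Heps. change (Rabs (y - 0) < eps). rewrite Rabs_pos_eq by lra.
    destruct eps as [e He]; simpl in *; lra. }
  rewrite E0, Rminus_0_r in HEy. apply Rabs_def2 in HEy.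
  destruct (MVT_gen (fun t => Rpower t c * E t) y x
     (fun t => Rpower t c / t * (t * dE t + c * E t))) as [t [Ht Hm]].
  - rewrite Rmin_left, Rmax_right by lra. intros t Ht.
    assert (Hp : is_derive (fun t => Rpower t c) t (c * Rpower t (c - 1))).
    { apply is_derive_Reals, derivable_pt_lim_power. lra. }
    assert (HEt := HE t ltac:(lra)).
    evar_last. { apply (is_derive_mult _ _ _ _ _ Hp HEt). intros; apply Rmult_comm. }
    unfold plus, mult; simpl. unfold Rminus. rewrite Rpower_plus, Rpower_Ropp, Rpower_1 by lra.
    field. lra.
  - rewrite Rmin_left, Rmax_right by lra. intros t Ht.
    apply (continuity_pt_mult (fun t => Rpower t c) E); apply derivable_continuous_pt.
    + eexists. apply derivable_pt_lim_power. lra.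
    + exists (dE t). apply is_derive_Reals, HE. lra.
  - rewrite Rmin_left, Rmax_right in Ht by lra.
    assert (0 <= Rpower t c / t * (t * dE t + c * E t)).
    { apply Rmult_le_pos; [|apply Hode; lra].
      apply Rlt_le, Rdiv_lt_0_compat; [apply exp_pos|lra]. }
    assert (0 <= Rpower x c * E x - Rpower y c * E y).
    { rewrite Hm. apply Rmult_le_pos; [auto|lra]. }
    assert (Hpy : 0 < Rpower y c <= 1).
    { split; [apply exp_pos|]. rewrite <- (Rpower_O y) by lra.
      unfold Rpower. rewrite Rmult_0_l, exp_0. rewrite <- exp_0.
      destruct (Req_dec y 1) as [->|]; [rewrite ln_1, Rmult_0_r; lra|].
      left. apply exp_increasing. assert (ln y < 0) by (rewrite <- ln_1; apply ln_increasing; lra). nra. }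
    unfold d in *. nra.
Qed.

(** * Comparison of the logarithmic derivative with the partial sums *)

Lemma regular_gt (mu : R) : -1 < mu -> regular mu.
Proof. intros Hmu n. pose proof (pos_INR n). lra. Qed.

Definition bfun (mu : R) : R -> R := PSeries (bcoef mu).
Definition bfun' (mu : R) : R -> R := PSeries (PS_derive (bcoef mu)).
Definition bfun'' (mu : R) : R -> R := PSeries (PS_derive (PS_derive (bcoef mu))).

Lemma is_derive_bfun (mu x : R) : regular mu -> is_derive (bfun mu) x (bfun' mu x).
Proof. intros Hr. apply is_derive_PSeries, entire_radius, bcoef_entire, Hr. Qed.

Lemma is_derive_bfun' (mu x : R) : regular mu -> is_derive (bfun' mu) x (bfun'' mu x).
Proof. intros Hr. apply is_derive_PSeries, entire_radius, entire_derive, bcoef_entire, Hr. Qed.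

Lemma bfun_ode (mu x : R) :
  regular mu -> x * bfun'' mu x + (mu + 1) * bfun' mu x + bfun mu x / 4 = 0.
Proof. apply bessel_ode. Qed.

Lemma bfun_0 (mu : R) : bfun mu 0 = 1.
Proof. unfold bfun. now rewrite PSeries_0. Qed.

Lemma bfun'_0 (mu : R) : mu + 1 <> 0 -> bfun' mu 0 = - / (4 * (mu + 1)).
Proof.
  intros Hmu. unfold bfun'. rewrite PSeries_0. unfold PS_derive. simpl. field.
  intros H; apply Hmu; lra.
Qed.

Definition blog (mu x : R) : R := - bfun' mu x / bfun mu x.

Lemma is_derive_blog (mu x : R) :
  regular mu -> bfun mu x <> 0 ->
  is_derive (blog mu) x (- bfun'' mu x / bfun mu x + blog mu x ^ 2).
Proof.
  intros Hr Hx. unfold blog.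
  evar_last.
  { apply (is_derive_div (fun x => - bfun' mu x) (bfun mu)); [|apply is_derive_bfun; auto|auto].
    apply (is_derive_opp (K:=R_AbsRing) (V:=R_NormedModule)), is_derive_bfun'; auto. }
  change (opp (bfun'' mu x)) with (- bfun'' mu x). field. auto.
Qed.

Lemma riccati_sum_0 (mu : R) (n : nat) : riccati_sum mu n 0 = riccati mu 0.
Proof.
  unfold riccati_sum. induction n as [|n IH]; [simpl; ring|].
  rewrite tech5, IH, pow_i by lia. ring.
Qed.

(** [blog] solves the full equation and the partial sum a truncated one. By induction the truncated
    square is at most the square of the previous partial sum, hence at most [blog ^ 2]; the degree 0
    sum solves the equation without any square. *)
Lemma riccati_sum_le_blog (mu X : R) (n : nat) :
  -1 < mu -> (forall x, 0 <= x < X -> 0 < bfun mu x) ->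
  forall x, 0 < x < X -> riccati_sum mu n x <= blog mu x.
Proof.
  intros Hmu Hpos. assert (Hr := regular_gt mu Hmu).
  (* Subtracting from the equation of [blog] turns this inequality into the hypothesis of
     [ode_nonneg] for the difference, which vanishes at 0 because both sides start with
     [/ (4 * (mu + 1))]. *)
  assert (step : forall n, (forall x, 0 < x < X ->
     x * riccati_dsum mu n x + (mu + 1) * riccati_sum mu n x <= / 4 + x * blog mu x ^ 2) ->
     forall x, 0 < x < X -> riccati_sum mu n x <= blog mu x).
  { clear n. intros n Hn x Hx.
    cut (0 <= blog mu x - riccati_sum mu n x); [lra|].
    revert x Hx.
    assert (D : forall x, bfun mu x <> 0 ->
      is_derive (fun x => blog mu x - riccati_sum mu n x) x
        (- bfun'' mu x / bfun mu x + blog mu x ^ 2 - riccati_dsum mu n x)).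
    { intros x Hx. apply (is_derive_minus (K:=R_AbsRing) (V:=R_NormedModule)).
      - apply is_derive_blog; auto.
      - apply is_derive_riccati_sum. }
    apply (ode_nonneg (fun x => blog mu x - riccati_sum mu n x)
       (fun x => - bfun'' mu x / bfun mu x + blog mu x ^ 2 - riccati_dsum mu n x) (mu + 1)).
    - lra.
    - rewrite riccati_sum_0, riccati_0. unfold blog. rewrite bfun_0, bfun'_0 by lra. field. lra.
    - apply (ex_derive_continuous (K:=R_AbsRing) (V:=R_NormedModule)). eexists. apply D.
      rewrite bfun_0. lra.
    - intros x Hx. apply D. apply Rgt_not_eq, Hpos. lra.
    - intros x Hx. specialize (Hn x Hx).
      assert (Hf : 0 < bfun mu x) by (apply Hpos; lra).
      assert (x * (- bfun'' mu x / bfun mu x) + (mu + 1) * blog mu x = / 4).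
      { unfold blog. pose proof (bfun_ode mu x Hr).
        replace (x * (- bfun'' mu x / bfun mu x) + (mu + 1) * (- bfun' mu x / bfun mu x))
          with ((- (x * bfun'' mu x + (mu + 1) * bfun' mu x)) / bfun mu x) by (field; lra).
        replace (- (x * bfun'' mu x + (mu + 1) * bfun' mu x)) with (bfun mu x / 4) by lra.
        field. lra. }
      lra. }
  induction n as [|n IH]; apply step; intros x Hx.
  - unfold riccati_dsum, riccati_sum. cbn [sum_f_R0]. rewrite riccati_0. simpl INR.
    replace ((mu + 1) * (/ (4 * (mu + 1)) * x ^ 0)) with (/ 4) by (simpl; field; lra).
    pose proof (pow2_ge_0 (blog mu x)). simpl pow. simpl pow in H. nra.
  - rewrite riccati_sum_ode by auto.
    pose proof (conv_le_square (riccati mu) x n (fun k => Rlt_le _ _ (riccati_pos mu k Hmu)) ltac:(lra)) as Hc.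
    fold (riccati_sum mu n x) in Hc.
    specialize (IH x Hx). pose proof (riccati_sum_nonneg mu n x Hmu ltac:(lra)).
    apply Rplus_le_compat_l, Rmult_le_compat_l; [lra|].
    eapply Rle_trans; [exact Hc|]. simpl. nra.
Qed.

Lemma ex_series_bounded (a : nat -> R) (M : R) :
  (forall n, 0 <= a n) -> (forall n, sum_f_R0 a n <= M) -> ex_series a.
Proof.
  intros Ha HM.
  destruct (ex_finite_lim_seq_incr (sum_n a) M) as [l Hl].
  - intros n. rewrite sum_Sn. unfold plus; simpl. specialize (Ha (S n)). lra.
  - intros n. rewrite sum_n_Reals. apply HM.
  - exists l. exact Hl.
Qed.

(** The terms are positive at a positive point, and [blog] bounds the partial sums there. *)
Lemma riccati_disk (mu X x : R) :
  -1 < mu -> (forall x, 0 <= x < X -> 0 < bfun mu x) -> Rabs x < X ->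
  CV_disk (riccati mu) x.
Proof.
  intros Hmu Hpos Hx.
  (* The midpoint is positive even when [x = 0], as the comparison requires. *)
  set (y := (Rabs x + X) / 2).
  assert (Hy : Rabs x < y < X) by (unfold y; lra).
  pose proof (Rabs_pos x).
  apply CV_disk_le with y; [rewrite (Rabs_pos_eq y); lra|].
  unfold CV_disk.
  assert (Hp : forall n, 0 <= riccati mu n * y ^ n).
  { intros n. apply Rmult_le_pos; [now apply Rlt_le, riccati_pos|apply pow_le; lra]. }
  apply (ex_series_ext (fun n => riccati mu n * y ^ n)).
  { intros n. now rewrite Rabs_pos_eq. }
  apply ex_series_bounded with (blog mu y); auto.
  intros n. apply (riccati_sum_le_blog mu X); auto; lra.
Qed.

Lemma riccati_radius (mu X x : R) :
  -1 < mu -> (forall x, 0 <= x < X -> 0 < bfun mu x) -> Rabs x < X ->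
  Rbar_lt (Rabs x) (CV_radius (riccati mu)).
Proof.
  intros Hmu Hpos Hx. pose proof (Rabs_pos x).
  apply Rbar_lt_le_trans with ((Rabs x + X) / 2); [simpl; lra|].
  rewrite <- (Rabs_pos_eq ((Rabs x + X) / 2)) by lra.
  apply CV_disk_radius, (riccati_disk mu X); auto. rewrite Rabs_pos_eq; lra.
Qed.

(** [rho] makes [n = 0] an equality. For a geometric sequence [c * rho ^ (n + 1)] the convolution
    has [n + 1] equal terms, so the induction needs [n + mu + 2 <= c * (n + 1)]. With [c = mu + 2]
    the gap is [n * (mu + 1)], and equality at [n = 0] shows that no smaller [c] would do. *)
Lemma riccati_lower (mu : R) (n : nat) :
  -1 < mu ->
  let rho := riccati mu 0 / (mu + 2) in
  (mu + 2) * rho ^ S n <= riccati mu n.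
Proof.
  intros Hmu rho.
  assert (Hrho : 0 < rho) by (apply Rdiv_lt_0_compat; [now apply riccati_pos|lra]).
  induction n as [n IH] using (well_founded_induction Wf_nat.lt_wf).
  destruct n as [|n].
  - right. simpl. unfold rho. field. lra.
  - pose proof (pos_INR n).
    apply Rmult_le_reg_l with (INR (S n) + mu + 1); [rewrite S_INR; lra|].
    rewrite riccati_S by auto.
    apply Rle_trans with (sum_f_R0 (fun _ => (mu + 2) ^ 2 * rho ^ S (S n)) n).
    + rewrite sum_cte.
      replace ((INR (S n) + mu + 1) * ((mu + 2) * rho ^ S (S n)))
        with ((INR (S n) + mu + 1) * (mu + 2) * rho ^ S (S n)) by ring.
      replace ((mu + 2) ^ 2 * rho ^ S (S n) * INR (S n))
        with ((mu + 2) ^ 2 * INR (S n) * rho ^ S (S n)) by ring.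
      apply Rmult_le_compat_r; [apply pow_le; lra|]. rewrite S_INR.
      assert (0 <= (mu + 2) * (INR n * (mu + 1))) by (repeat apply Rmult_le_pos; lra). nra.
    + apply sum_Rle. intros k Hk.
      replace ((mu + 2) ^ 2 * rho ^ S (S n))
        with (((mu + 2) * rho ^ S k) * ((mu + 2) * rho ^ S (n - k))).
      2:{ replace (S (S n)) with (S k + S (n - k))%nat by lia. rewrite pow_add. ring. }
      assert (forall j, 0 <= (mu + 2) * rho ^ S j).
      { intros j. apply Rmult_le_pos; [lra|apply pow_le; lra]. }
      apply Rmult_le_compat; auto; apply IH; lia.
Qed.

(** If [f] stayed positive, [blog (/ rho)] would bound all partial sums at [/ rho], where by
    [riccati_lower] each term is at least [(mu + 2) * rho]. *)
Lemma bfun_nonpos_exists (mu : R) : -1 < mu -> exists x, 0 < x /\ bfun mu x <= 0.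
Proof.
  intros Hmu.
  set (rho := riccati mu 0 / (mu + 2)).
  assert (Hrho : 0 < rho) by (apply Rdiv_lt_0_compat; [now apply riccati_pos|lra]).
  destruct (Classical_Prop.classic (exists x, 0 < x /\ bfun mu x <= 0)) as [|Hno]; auto.
  exfalso.
  (* The summand 1 only puts [/ rho] strictly inside the interval. *)
  assert (Hpos : forall x, 0 <= x < / rho + 1 -> 0 < bfun mu x).
  { intros x Hx. destruct (Rlt_le_dec 0 (bfun mu x)) as [|Hle]; auto.
    exfalso. apply Hno. exists x. split; auto.
    destruct (Req_dec x 0) as [->|]; [rewrite bfun_0 in Hle|]; lra. }
  assert (Hir : 0 < / rho) by now apply Rinv_0_lt_compat.
  assert (Hle : forall n, (mu + 2) * rho * INR (S n) <= blog mu (/ rho)).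
  { intros n. eapply Rle_trans; [|apply (riccati_sum_le_blog mu (/ rho + 1) n); auto; lra].
    rewrite <- sum_cte. apply sum_Rle. intros k _.
    apply Rle_trans with ((mu + 2) * rho ^ S k * (/ rho) ^ k).
    - right. rewrite pow_inv. simpl. field. apply pow_nonzero. lra.
    - apply Rmult_le_compat_r; [apply pow_le; lra|]. now apply riccati_lower. }
  assert (Hc : 0 < (mu + 2) * rho) by (apply Rmult_lt_0_compat; lra).
  destruct (INR_unbounded (blog mu (/ rho) / ((mu + 2) * rho))) as [n Hn].
  specialize (Hle n).
  assert (blog mu (/ rho) < (mu + 2) * rho * INR n).
  { apply Rmult_lt_reg_r with (/ ((mu + 2) * rho)); [now apply Rinv_0_lt_compat|].
    eapply Rlt_le_trans; [exact Hn|]. right. field. lra. }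
  rewrite S_INR in Hle. nra.
Qed.

(** The shift makes the right side at index [n] depend on [d] at smaller indices only, and the
    factor on the left is positive. *)
Lemma PS_mult_ode (mu : R) (d h : nat -> R) :
  -1 < mu ->
  (forall n, (INR n + mu + 1) * d n = PS_incr_1 (PS_mult h d) n) ->
  forall n, d n = 0.
Proof.
  intros Hmu Hd n.
  induction n as [n IH] using (well_founded_induction Wf_nat.lt_wf).
  specialize (Hd n). pose proof (pos_INR n).
  apply Rmult_eq_reg_l with (INR n + mu + 1); [|lra].
  rewrite Hd, Rmult_0_r. destruct n as [|n]; [reflexivity|].
  change (PS_mult h d n = 0). unfold PS_mult.
  rewrite (sum_eq _ (fun _ => 0)); [rewrite sum_cte; ring|].
  intros k Hk. rewrite (IH (n - k)%nat) by lia. ring.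
Qed.

Lemma riccati_PSeries_ode (mu X x : R) :
  -1 < mu -> (forall x, 0 <= x < X -> 0 < bfun mu x) -> Rabs x < X ->
  x * PSeries (PS_derive (riccati mu)) x + (mu + 1) * PSeries (riccati mu) x
  = / 4 + x * PSeries (riccati mu) x ^ 2.
Proof.
  intros Hmu Hpos Hx.
  assert (Hrad := riccati_radius mu X x Hmu Hpos Hx).
  assert (X0 := CV_radius_inside _ _ Hrad).
  assert (X1 : ex_pseries (PS_derive (riccati mu)) x).
  { apply CV_radius_inside. now rewrite CV_radius_derive. }
  assert (X2 : ex_pseries (PS_mult (riccati mu) (riccati mu)) x) by now apply ex_pseries_mult.
  replace (PSeries (riccati mu) x ^ 2) with (PSeries (riccati mu) x * PSeries (riccati mu) x) by ring.
  rewrite <- PSeries_mult by auto.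
  rewrite <- !PSeries_incr_1, <- PSeries_scal.
  rewrite <- PSeries_plus; [|now apply ex_pseries_incr_1|apply ex_pseries_scal; auto; apply Rmult_comm].
  rewrite PSeries_decr_1.
  2:{ apply ex_pseries_plus; [now apply ex_pseries_incr_1|apply ex_pseries_scal; auto; apply Rmult_comm]. }
  rewrite PSeries_incr_1. f_equal.
  - change (0 + (mu + 1) * riccati mu 0 = / 4). rewrite riccati_0. field. lra.
  - f_equal. apply PSeries_ext. intros n. rewrite <- riccati_S by auto.
    change (INR (S n) * riccati mu (S n) + (mu + 1) * riccati mu (S n) = (INR (S n) + mu + 1) * riccati mu (S n)).
    ring.
Qed.

(** The intermediate value theorem gives some zero; the first one is the supremum of the points up
    to which [g] is positive. *)
Lemma first_zero (g : R -> R) (b : R) :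
  (forall x, continuity_pt g x) -> 0 < b -> 0 < g 0 -> g b <= 0 ->
  exists r, 0 < r <= b /\ g r = 0 /\ forall x, 0 <= x < r -> 0 < g x.
Proof.
  intros Hg Hb H0 Hgb.
  destruct (completeness (fun x => 0 <= x <= b /\ forall y, 0 <= y <= x -> 0 < g y))
    as [r [Hub Hlub]].
  { exists b. intros x [Hx _]. lra. }
  { exists 0. split; [lra|]. intros y Hy. now replace y with 0 by lra. }
  assert (Hr0 : 0 <= r). { apply Hub. split; [lra|]. intros y Hy. now replace y with 0 by lra. }
  assert (Hrb : r <= b). { apply Hlub. intros x [Hx _]. lra. }
  assert (Hpos : forall x, 0 <= x < r -> 0 < g x).
  { intros x Hx. destruct (Rlt_le_dec 0 (g x)) as [|Hle]; auto. exfalso.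
    apply (Rlt_not_le r x); [lra|]. apply Hlub. intros y [Hy1 Hy2].
    destruct (Rle_lt_dec y x) as [|Hlt]; auto. specialize (Hy2 x). lra. }
  assert (Hnbhd : forall e, 0 < e -> exists d, 0 < d /\ forall y, Rabs (y - r) < d -> Rabs (g y - g r) < e).
  { intros e He. destruct (Hg r e He) as [d [Hd Hdd]]. exists d. split; auto.
    intros y Hy. destruct (Req_dec y r) as [->|Hne].
    - unfold Rminus. rewrite Rplus_opp_r, Rabs_R0. exact He.
    - apply Hdd. split; [split; [exact I|auto]|exact Hy]. }
  assert (Hz : g r = 0).
  { destruct (Rtotal_order (g r) 0) as [Hn|[|Hp]]; auto; exfalso.
    - destruct (Hnbhd (- g r)) as [d [Hd Hdd]]; [lra|].
      assert (r <> 0) by (intros ->; lra).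
      set (y := Rmax 0 (r - d / 2)).
      assert (0 <= y < r /\ r - d / 2 <= y).
      { unfold y. repeat split; [apply Rmax_l|apply Rmax_lub_lt; lra|apply Rmax_r]. }
      assert (Hy : Rabs (y - r) < d) by (rewrite Rabs_left; lra).
      apply Hdd, Rabs_def2 in Hy. pose proof (Hpos y). lra.
    - destruct (Hnbhd (g r)) as [d [Hd Hdd]]; [lra|].
      assert (r <> b) by (intros ->; lra).
      set (y := Rmin b (r + d / 2)).
      assert (r < y /\ y <= b /\ y <= r + d / 2).
      { unfold y. repeat split; [apply Rmin_glb_lt; lra|apply Rmin_l|apply Rmin_r]. }
      apply (Rlt_not_le y r); [lra|]. apply Hub. split; [lra|].
      intros t Ht. destruct (Rlt_le_dec t r); [apply Hpos; lra|].
      assert (Hy : Rabs (t - r) < d) by (rewrite Rabs_pos_eq; lra).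
      apply Hdd, Rabs_def2 in Hy. lra. }
  exists r. repeat split; auto. destruct Hr0 as [|<-]; auto. lra.
Qed.

Lemma continuity_bfun (mu x : R) : regular mu -> continuity_pt (bfun mu) x.
Proof.
  intros Hr. apply derivable_continuous_pt. exists (bfun' mu x).
  now apply is_derive_Reals, is_derive_bfun.
Qed.

Lemma continuity_bfun' (mu x : R) : regular mu -> continuity_pt (bfun' mu) x.
Proof.
  intros Hr. apply derivable_continuous_pt. exists (bfun'' mu x).
  now apply is_derive_Reals, is_derive_bfun'.
Qed.

Lemma bfun_first_zero (mu : R) :
  -1 < mu ->
  exists X, 0 < X /\ bfun mu X = 0 /\ forall x, 0 <= x < X -> 0 < bfun mu x.
Proof.
  intros Hmu. destruct (bfun_nonpos_exists mu Hmu) as [b [Hb Hfb]].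
  destruct (first_zero (bfun mu) b) as [X [HX1 [HX2 HX3]]]; auto.
  - intros x. apply continuity_bfun, regular_gt, Hmu.
  - rewrite bfun_0. lra.
  - exists X. repeat split; auto; lra.
Qed.

(** * The identity [f' = - h f] between power series *)

Lemma ex_pseries_radius (a : nat -> R) (x : R) :
  ex_pseries a x -> Rbar_le (Rabs x) (CV_radius a).
Proof.
  intros Hx. apply Rbar_not_lt_le. intros Hlt.
  apply (CV_disk_outside a x Hlt). apply ex_series_lim_0.
  eapply ex_series_ext; [|exact Hx]. intros n. simpl. rewrite pow_n_pow. apply Rmult_comm.
Qed.

Lemma ex_pseries_radius_pos (a : nat -> R) (X : R) :
  0 < X -> (forall x, Rabs x < X -> ex_pseries a x) ->
  forall x, Rabs x < X -> Rbar_lt (Rabs x) (CV_radius a).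
Proof.
  intros HX Ha x Hx. pose proof (Rabs_pos x).
  apply Rbar_lt_le_trans with (Rabs ((Rabs x + X) / 2)).
  - simpl. rewrite (Rabs_pos_eq ((Rabs x + X) / 2)); lra.
  - apply ex_pseries_radius, Ha. rewrite (Rabs_pos_eq ((Rabs x + X) / 2)); lra.
Qed.

(* The defect [d = f' + h f] solves [x d' + (mu + 1) d = x h d], whose only power
   series solution is 0. *)
Lemma bcoef_log_derivative (mu : R) (n : nat) :
  -1 < mu -> PS_derive (bcoef mu) n = - PS_mult (riccati mu) (bcoef mu) n.
Proof.
  intros Hmu. assert (Hr := regular_gt mu Hmu).
  destruct (bfun_first_zero mu Hmu) as [X [HX [_ Hpos]]].
  set (h := riccati mu). set (a := bcoef mu).
  set (d := PS_plus (PS_derive a) (PS_mult h a)).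
  assert (Ra : entire a) by now apply bcoef_entire.
  assert (Rh : forall x, Rabs x < X -> Rbar_lt (Rabs x) (CV_radius h)).
  { intros x Hx. apply (riccati_radius mu X); auto. }
  assert (Xm : forall x, Rabs x < X -> ex_pseries (PS_mult h a) x).
  { intros x Hx. apply ex_pseries_mult; [auto|now apply entire_radius]. }
  assert (X1 : forall x, ex_pseries (PS_derive a) x).
  { intros x. apply CV_radius_inside, entire_radius, entire_derive, Ra. }
  assert (Xd : forall x, Rabs x < X -> ex_pseries d x).
  { intros x Hx. apply ex_pseries_plus; auto. }
  assert (Rd := ex_pseries_radius_pos d X HX Xd).
  assert (Xh : forall x, Rabs x < X -> ex_pseries (PS_mult h d) x).
  { intros x Hx. apply ex_pseries_mult; auto. }
  assert (Ed : forall x, Rabs x < X -> PSeries d x = bfun' mu x + PSeries h x * bfun mu x).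
  { intros x Hx. unfold d. rewrite PSeries_plus, PSeries_mult; auto. now apply entire_radius. }
  assert (Dd : forall x, Rabs x < X ->
     PSeries (PS_derive d) x = bfun'' mu x + PSeries (PS_derive h) x * bfun mu x + PSeries h x * bfun' mu x).
  { intros x Hx. rewrite <- Derive_PSeries by auto.
    apply is_derive_unique.
    apply (is_derive_ext_loc (fun x => bfun' mu x + PSeries h x * bfun mu x)).
    { assert (0 < X - Rabs x) by lra. exists (mkposreal _ H). intros y Hy.
      symmetry. apply Ed. change (Rabs (y - x) < X - Rabs x) in Hy.
      pose proof (Rabs_triang_inv y x). lra. }
    evar_last.
    { apply (is_derive_plus (K:=R_AbsRing) (V:=R_NormedModule)).
      - now apply is_derive_bfun'.
      - apply (is_derive_mult (PSeries h) (bfun mu)); [now apply is_derive_PSeries, Rh|now apply is_derive_bfun|].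
        intros; apply Rmult_comm. }
    unfold plus, mult; simpl. ring. }
  (* [A] and [B] are the two sides of the equation of [d]. They are compared as functions on
     [(-X, X)], where the products are pointwise, and uniqueness of power series brings the equality
     back to coefficients. *)
  set (A := PS_plus (PS_incr_1 (PS_derive d)) (PS_scal (mu + 1) d)).
  set (B := PS_incr_1 (PS_mult h d)).
  assert (XdX : forall x, Rabs x < X -> ex_pseries (PS_derive d) x).
  { intros x Hx. apply CV_radius_inside. rewrite CV_radius_derive. auto. }
  assert (XA : forall x, Rabs x < X -> ex_pseries A x).
  { intros x Hx. apply ex_pseries_plus; [apply ex_pseries_incr_1; auto|].
    apply ex_pseries_scal; auto. apply Rmult_comm. }
  assert (XB : forall x, Rabs x < X -> ex_pseries B x).
  { intros x Hx. apply ex_pseries_incr_1. auto. }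
  assert (HAB : forall n, A n = B n).
  { assert (P0 : Rabs 0 < X) by (rewrite Rabs_R0; auto).
    intros k. apply PSeries_ext_recip.
    - rewrite <- Rabs_R0. apply (ex_pseries_radius_pos A X); auto.
    - rewrite <- Rabs_R0. apply (ex_pseries_radius_pos B X); auto.
    - exists (mkposreal X HX). intros x Hx.
      change (Rabs (x - 0) < X) in Hx. rewrite Rminus_0_r in Hx.
      unfold A, B. rewrite PSeries_plus, PSeries_scal, !PSeries_incr_1, PSeries_mult by
        (auto; try (apply ex_pseries_incr_1; auto); apply ex_pseries_scal; auto; apply Rmult_comm).
      rewrite Ed, Dd by auto.
      pose proof (bfun_ode mu x Hr) as O.
      pose proof (riccati_PSeries_ode mu X x Hmu Hpos Hx) as O2. fold h in O2.
      transitivity (x * bfun'' mu x + (mu + 1) * bfun' mu x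
        + bfun mu x * (x * PSeries (PS_derive h) x + (mu + 1) * PSeries h x) + x * PSeries h x * bfun' mu x); [ring|].
      rewrite O2. replace (x * bfun'' mu x + (mu + 1) * bfun' mu x) with (- (bfun mu x / 4)) by lra.
      field. }
  assert (Hd : d n = 0).
  { apply (PS_mult_ode mu d h Hmu). intros k. transitivity (A k); [|exact (HAB k)]. unfold A.
    destruct k as [|k].
    - change ((0 + mu + 1) * d O = 0 + (mu + 1) * d O). ring.
    - change ((INR (S k) + mu + 1) * d (S k) = INR (S k) * d (S k) + (mu + 1) * d (S k)). ring. }
  change (PS_derive a n + PS_mult h a n = 0) in Hd. lra.
Qed.

(** * Complex power series *)

(** Convergence by components, to match [CSeries], which sums real and imaginary parts
    separately. *)
Definition is_Cseries (u : nat -> C) (l : C) : Prop :=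
  is_series (fun n => Re (u n)) (Re l) /\ is_series (fun n => Im (u n)) (Im l).

Lemma is_Cseries_unique (u : nat -> C) (l : C) : is_Cseries u l -> CSeries u = l.
Proof.
  intros [H1 H2]. unfold CSeries.
  rewrite (is_series_unique _ _ H1), (is_series_unique _ _ H2). now destruct l.
Qed.

Lemma is_Cseries_ext (u v : nat -> C) (l : C) :
  (forall n, u n = v n) -> is_Cseries u l -> is_Cseries v l.
Proof.
  intros E [H1 H2]. split; eapply is_series_ext; eauto; intros n; simpl; now rewrite E.
Qed.

Lemma is_Cseries_scal (c : C) (u : nat -> C) (l : C) :
  is_Cseries u l -> is_Cseries (fun n => c * u n)%C (c * l)%C.
Proof.
  intros [H1 H2]. split.
  - exact (is_series_minus _ _ _ _ (is_series_scal (Re c) _ _ H1) (is_series_scal (Im c) _ _ H2)).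
  - exact (is_series_plus _ _ _ _ (is_series_scal (Re c) _ _ H2) (is_series_scal (Im c) _ _ H1)).
Qed.

Lemma is_Cseries_minus (u v : nat -> C) (k l : C) :
  is_Cseries u k -> is_Cseries v l -> is_Cseries (fun n => u n - v n)%C (k - l)%C.
Proof.
  intros [H1 H2] [H3 H4]. split.
  - exact (is_series_minus _ _ _ _ H1 H3).
  - exact (is_series_minus _ _ _ _ H2 H4).
Qed.

Lemma im_le_Cmod (c : C) : Rabs (Im c) <= Cmod c.
Proof. eapply Rle_trans; [apply Rmax_r|apply Rmax_Cmod]. Qed.

Lemma ex_series_Rabs_le (a b : nat -> R) :
  (forall n, Rabs (a n) <= b n) -> ex_series b -> ex_series (fun n => Rabs (a n)).
Proof.
  intros Hab Hb. apply (ex_series_le (K:=R_AbsRing) (V:=R_CompleteNormedModule) _ b); auto.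
  intros n. change (Rabs (Rabs (a n)) <= b n). now rewrite Rabs_Rabsolu.
Qed.

Lemma is_Cseries_dominated (u : nat -> C) (b : nat -> R) :
  (forall n, Cmod (u n) <= b n) -> ex_series b -> is_Cseries u (CSeries u).
Proof.
  intros Hu Hb. split; apply Series_correct, ex_series_Rabs, (ex_series_Rabs_le _ b); auto; intros n.
  - eapply Rle_trans; [apply re_le_Cmod|auto].
  - eapply Rle_trans; [apply im_le_Cmod|auto].
Qed.

(** The factor 2 comes from bounding the two components apart. It is harmless, since the bound only
    feeds the constant of a Taylor estimate. *)
Lemma is_Cseries_norm (u : nat -> C) (b : nat -> R) (l : C) :
  is_Cseries u l -> (forall n, Cmod (u n) <= b n) -> ex_series b -> Cmod l <= 2 * Series b.
Proof.
  intros Hl Hu Hb.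
  assert (H : forall v : nat -> R, (forall n, Rabs (v n) <= b n) -> Rabs (Series v) <= Series b).
  { intros v Hv. eapply Rle_trans.
    - apply Series_Rabs, (ex_series_Rabs_le _ b); auto.
    - apply Series_le; auto. intros n. split; [apply Rabs_pos|auto]. }
  destruct Hl as [H1 H2].
  apply is_series_unique in H1. apply is_series_unique in H2.
  assert (Rabs (Re l) <= Series b).
  { rewrite <- H1. apply H. intros n. eapply Rle_trans; [apply re_le_Cmod|auto]. }
  assert (Rabs (Im l) <= Series b).
  { rewrite <- H2. apply H. intros n. eapply Rle_trans; [apply im_le_Cmod|auto]. }
  replace l with (RtoC (Re l) + Ci * RtoC (Im l))%C.
  2:{ destruct l as [x y]. unfold Cplus, Cmult, RtoC, Ci; simpl. f_equal; ring. }
  eapply Rle_trans; [apply Cmod_triangle|].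
  rewrite Cmod_mult, Cmod_Ci, !Cmod_R. lra.
Qed.

Definition CPS (a : nat -> R) (z : C) : C := CSeries (fun n => RtoC (a n) * z ^ n)%C.

Lemma Cmod_term (a : nat -> R) (z : C) (n : nat) :
  Cmod (RtoC (a n) * z ^ n)%C = Rabs (a n * Cmod z ^ n).
Proof.
  rewrite Cmod_mult, Cmod_R, Cmod_pow, Rabs_mult. f_equal.
  symmetry. apply Rabs_pos_eq, pow_le, Cmod_ge_0.
Qed.

Lemma CPS_correct (a : nat -> R) (z : C) :
  CV_disk a (Cmod z) -> is_Cseries (fun n => RtoC (a n) * z ^ n)%C (CPS a z).
Proof.
  intros Ha. apply (is_Cseries_dominated _ (fun n => Rabs (a n * Cmod z ^ n))); [|exact Ha].
  intros n. rewrite Cmod_term. lra.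
Qed.

Lemma CPS_RtoC (a : nat -> R) (x : R) : CPS a (RtoC x) = RtoC (PSeries a x).
Proof.
  unfold CPS, CSeries, PSeries, RtoC. f_equal.
  - apply Series_ext. intros n. fold (RtoC (a n)) (RtoC x). rewrite <- RtoC_pow. simpl. ring.
  - rewrite (Series_ext _ (fun _ => 0 * 0)); [rewrite Series_scal_l; ring|].
    intros n. fold (RtoC (a n)) (RtoC x). rewrite <- RtoC_pow. simpl. ring.
Qed.

Lemma CPS_ext (a b : nat -> R) (z : C) : (forall n, a n = b n) -> CPS a z = CPS b z.
Proof.
  intros E. unfold CPS, CSeries. f_equal; apply Series_ext; intros n; now rewrite E.
Qed.

Lemma CPS_scal (c : R) (a : nat -> R) (z : C) :
  CV_disk a (Cmod z) -> CPS (fun n => c * a n) z = (RtoC c * CPS a z)%C.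
Proof.
  intros Ha. apply is_Cseries_unique.
  apply (is_Cseries_ext (fun n => RtoC c * (RtoC (a n) * z ^ n))%C).
  - intros n. rewrite RtoC_mult. ring.
  - now apply is_Cseries_scal, CPS_correct.
Qed.

(** The triangle inequality on real parts alone. No constant may be lost here: equality at
    [z = Cmod z] is what makes the radius exact. *)
Lemma Re_CPS_le (a : nat -> R) (z : C) :
  (forall n, 0 <= a n) -> CV_disk a (Cmod z) ->
  Re (z * CPS a z)%C <= Cmod z * PSeries a (Cmod z).
Proof.
  intros Hp Ha. destruct (is_Cseries_scal z _ _ (CPS_correct a z Ha)) as [H _].
  rewrite <- (is_series_unique _ _ H). unfold PSeries. rewrite <- Series_scal_l.
  assert (Hb : forall n, Rabs (Re (z * (RtoC (a n) * z ^ n))%C) <= Cmod z * (a n * Cmod z ^ n)).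
  { intros n. eapply Rle_trans; [apply re_le_Cmod|].
    rewrite Cmod_mult, Cmod_mult, Cmod_R, Cmod_pow, Rabs_pos_eq by auto. lra. }
  assert (ex_series (fun n => Cmod z * (a n * Cmod z ^ n))).
  { apply (ex_series_scal (Cmod z) (fun n => a n * Cmod z ^ n)). apply ex_series_Rabs, Ha. }
  eapply Rle_trans; [apply Rle_abs|]. eapply Rle_trans.
  - apply Series_Rabs, (ex_series_Rabs_le _ _ Hb); auto.
  - apply Series_le; auto. intros n. split; [apply Rabs_pos|apply Hb].
Qed.

Lemma Re_mult (v w : C) : Re (v * w)%C = Re v * Re w - Im v * Im w.
Proof. reflexivity. Qed.

Lemma Im_mult (v w : C) : Im (v * w)%C = Re v * Im w + Im v * Re w.
Proof. reflexivity. Qed.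

Lemma Re_scal (x : R) (w : C) : Re (RtoC x * w)%C = x * Re w.
Proof. rewrite Re_mult. unfold RtoC, Im, Re. simpl. ring. Qed.

Lemma Im_scal (x : R) (w : C) : Im (RtoC x * w)%C = x * Im w.
Proof. rewrite Im_mult. unfold RtoC, Im, Re. simpl. ring. Qed.

(** Four real Cauchy products of absolutely convergent series, one for each pair of components. *)
Lemma CPS_mult (a b : nat -> R) (z : C) :
  CV_disk a (Cmod z) -> CV_disk b (Cmod z) ->
  CPS (PS_mult a b) z = (CPS a z * CPS b z)%C.
Proof.
  intros Ha Hb. apply is_Cseries_unique.
  assert (HR : forall c : nat -> R, CV_disk c (Cmod z) ->
            ex_series (fun n => Rabs (Re (RtoC (c n) * z ^ n)%C))).
  { intros c Hc. eapply ex_series_Rabs_le; [|exact Hc].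
    intros n. cbv beta. rewrite <- Cmod_term. apply re_le_Cmod. }
  assert (HI : forall c : nat -> R, CV_disk c (Cmod z) ->
            ex_series (fun n => Rabs (Im (RtoC (c n) * z ^ n)%C))).
  { intros c Hc. eapply ex_series_Rabs_le; [|exact Hc].
    intros n. cbv beta. rewrite <- Cmod_term. apply im_le_Cmod. }
  destruct (CPS_correct a z Ha) as [A1 A2]. destruct (CPS_correct b z Hb) as [B1 B2].
  assert (P1 := is_series_mult _ _ _ _ A1 B1 (HR a Ha) (HR b Hb)).
  assert (P2 := is_series_mult _ _ _ _ A2 B2 (HI a Ha) (HI b Hb)).
  assert (P3 := is_series_mult _ _ _ _ A1 B2 (HR a Ha) (HI b Hb)).
  assert (P4 := is_series_mult _ _ _ _ A2 B1 (HI a Ha) (HR b Hb)).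
  split.
  - eapply is_series_ext; [|exact (is_series_minus _ _ _ _ P1 P2)].
    intros n. rewrite Re_scal. refine (eq_trans (eq_sym (minus_sum _ _ _)) _). unfold PS_mult. rewrite Rmult_comm, scal_sum.
    apply sum_eq. intros k Hk. rewrite ?Re_scal, ?Im_scal.
    replace (z ^ n)%C with (z ^ k * z ^ (n - k))%C by (rewrite <- Cpow_add_r; f_equal; lia).
    rewrite ?Re_mult, ?Im_mult. ring.
  - eapply is_series_ext; [|exact (is_series_plus _ _ _ _ P3 P4)].
    intros n. rewrite Im_scal. refine (eq_trans (eq_sym (plus_sum _ _ _)) _). unfold PS_mult. rewrite Rmult_comm, scal_sum.
    apply sum_eq. intros k Hk. rewrite ?Re_scal, ?Im_scal.
    replace (z ^ n)%C with (z ^ k * z ^ (n - k))%C by (rewrite <- Cpow_add_r; f_equal; lia).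
    rewrite ?Re_mult, ?Im_mult. ring.
Qed.

(** The remainders satisfy [R_(n+1) = w * R_n + n * z ^ (n - 1) * d ^ 2], and
    [n ^ 2 + n <= (n + 1) ^ 2]. The condition [1 <= rho] absorbs the lower powers of [rho]. *)
Lemma pow_taylor (w z : C) (rho : R) (n : nat) :
  1 <= rho -> Cmod w <= rho -> Cmod z <= rho ->
  Cmod (w ^ n - z ^ n - (w - z) * (RtoC (INR n) * z ^ pred n))%C
  <= INR n ^ 2 * rho ^ n * Cmod (w - z)%C ^ 2.
Proof.
  intros Hrho Hw Hz. set (d := (w - z)%C).
  assert (Hd : 0 <= Cmod d ^ 2) by apply pow2_ge_0.
  assert (Hp : forall k, Cmod (z ^ k)%C <= rho ^ k).
  { intros k. rewrite Cmod_pow. apply pow_incr. split; [apply Cmod_ge_0|auto]. }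
  induction n as [|n IH].
  - replace (w ^ 0 - z ^ 0 - d * (RtoC (INR 0) * z ^ pred 0))%C with (RtoC 0).
    + rewrite Cmod_0. simpl. lra.
    + simpl. ring.
  - replace (w ^ S n - z ^ S n - d * (RtoC (INR (S n)) * z ^ pred (S n)))%C
      with (w * (w ^ n - z ^ n - d * (RtoC (INR n) * z ^ pred n))
            + d * d * (RtoC (INR n) * z ^ pred n))%C.
    2:{ rewrite S_INR, RtoC_plus, !Cpow_S. simpl pred. destruct n as [|n].
        - simpl. unfold d. ring.
        - rewrite !Cpow_S. simpl pred. unfold d. ring. }
    eapply Rle_trans; [apply Cmod_triangle|].
    rewrite !Cmod_mult, Cmod_R, Rabs_pos_eq by apply pos_INR.
    assert (H1 : Cmod w * Cmod (w ^ n - z ^ n - d * (RtoC (INR n) * z ^ pred n))%C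
                 <= rho * (INR n ^ 2 * rho ^ n * Cmod d ^ 2)).
    { apply Rmult_le_compat; auto using Cmod_ge_0. }
    assert (H2 : Cmod (z ^ pred n)%C <= rho ^ S n).
    { eapply Rle_trans; [apply Hp|]. apply Rle_pow; [auto|lia]. }
    assert (H3 : Cmod d * Cmod d * (INR n * Cmod (z ^ pred n)%C) <= INR n * rho ^ S n * Cmod d ^ 2).
    { replace (Cmod d * Cmod d * (INR n * Cmod (z ^ pred n)%C))
        with (INR n * Cmod (z ^ pred n)%C * Cmod d ^ 2) by ring.
      apply Rmult_le_compat_r; auto. apply Rmult_le_compat_l; auto using pos_INR. }
    assert (H4 : 0 <= rho ^ S n * Cmod d ^ 2) by (apply Rmult_le_pos; [apply pow_le; lra|auto]).
    rewrite S_INR. pose proof (pos_INR n).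
    replace (rho * (INR n ^ 2 * rho ^ n * Cmod d ^ 2)) with (INR n ^ 2 * (rho ^ S n * Cmod d ^ 2)) in H1 by (simpl; ring).
    replace (INR n * rho ^ S n * Cmod d ^ 2) with (INR n * (rho ^ S n * Cmod d ^ 2)) in H3 by ring.
    replace ((INR n + 1) ^ 2 * rho ^ S n * Cmod d ^ 2) with ((INR n + 1) ^ 2 * (rho ^ S n * Cmod d ^ 2)) by ring.
    nra.
Qed.

Lemma INR_le_pow2 (n : nat) : INR n <= 2 ^ n.
Proof.
  induction n as [|n IH]; [simpl; lra|].
  rewrite S_INR. assert (1 <= 2 ^ n) by (apply pow_R1_Rle; lra). simpl. lra.
Qed.

(** The derived series is indexed like the original one, so that the Taylor remainder can be
    estimated term by term; the extra term of index 0 vanishes. *)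
Lemma CPS_derive_correct (a : nat -> R) (z : C) :
  entire a ->
  is_Cseries (fun n => RtoC (a n) * (RtoC (INR n) * z ^ pred n))%C (CPS (PS_derive a) z).
Proof.
  intros Ha.
  destruct (CPS_correct (PS_derive a) z) as [H1 H2].
  { apply entire_disk, entire_derive, Ha. }
  assert (E : forall n, (RtoC (PS_derive a n) * z ^ n
                = RtoC (a (S n)) * (RtoC (INR (S n)) * z ^ pred (S n)))%C).
  { intros n. unfold PS_derive. rewrite RtoC_mult. simpl pred. ring. }
  assert (E0 : (RtoC (a O) * (RtoC (INR 0) * z ^ pred 0))%C = RtoC 0).
  { simpl. ring. }
  split; apply is_series_decr_1; rewrite E0.
  - match goal with |- is_series _ ?l => replace l with (Re (CPS (PS_derive a) z)) end.
    + eapply is_series_ext; [|exact H1]. intros n. cbv beta. now rewrite E.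
    + unfold plus, opp; simpl. ring.
  - match goal with |- is_series _ ?l => replace l with (Im (CPS (PS_derive a) z)) end.
    + eapply is_series_ext; [|exact H2]. intros n. cbv beta. now rewrite E.
    + unfold plus, opp; simpl. ring.
Qed.

(** One constant for the whole disk serves both the complex derivative and the real derivatives
    along rays. *)
Lemma CPS_taylor (a : nat -> R) (rho : R) :
  entire a -> 1 <= rho ->
  exists M, forall w z, Cmod w <= rho -> Cmod z <= rho ->
    Cmod (CPS a w - CPS a z - (w - z) * CPS (PS_derive a) z)%C <= M * Cmod (w - z)%C ^ 2.
Proof.
  intros Ha Hrho.
  assert (Hs : ex_series (fun n => Rabs (a n) * (INR n ^ 2 * rho ^ n))).
  { apply ex_series_Rabs.
    (* The weight [n ^ 2] is at most [4 ^ n], and an entire series converges absolutely at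
       [4 * rho]. *)
    apply ex_series_Rabs_le with (fun n => Rabs (a n * (4 * rho) ^ n)); [|apply entire_disk, Ha].
    intros n. rewrite !Rabs_mult, Rabs_Rabsolu.
    apply Rmult_le_compat_l; [apply Rabs_pos|].
    rewrite <- Rabs_mult, !Rabs_pos_eq.
    - rewrite Rpow_mult_distr. apply Rmult_le_compat_r; [apply pow_le; lra|].
      replace (4 ^ n) with ((2 ^ n) ^ 2).
      + apply pow_incr. split; [apply pos_INR|apply INR_le_pow2].
      + rewrite <- pow_mult, Nat.mul_comm, pow_mult. f_equal. ring.
    - apply pow_le. lra.
    - apply Rmult_le_pos; [apply pow2_ge_0|apply pow_le; lra]. }
  exists (2 * Series (fun n => Rabs (a n) * (INR n ^ 2 * rho ^ n))).
  intros w z Hw Hz.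
  assert (Hd : forall x, CV_disk a x) by (intros x; now apply entire_disk).
  assert (Hl := is_Cseries_minus _ _ _ _
    (is_Cseries_minus _ _ _ _ (CPS_correct a w (Hd _)) (CPS_correct a z (Hd _)))
    (is_Cseries_scal (w - z)%C _ _ (CPS_derive_correct a z Ha))).
  replace (2 * Series (fun n => Rabs (a n) * (INR n ^ 2 * rho ^ n)) * Cmod (w - z)%C ^ 2)
    with (2 * Series (fun n => Cmod (w - z)%C ^ 2 * (Rabs (a n) * (INR n ^ 2 * rho ^ n)))).
  2:{ rewrite Series_scal_l. ring. }
  apply (is_Cseries_norm _ _ _ Hl); [|exact (ex_series_scal (K:=R_AbsRing) (V:=R_NormedModule) (Cmod (w - z)%C ^ 2) _ Hs)].
  intros n. cbv beta.
  replace (RtoC (a n) * w ^ n - RtoC (a n) * z ^ n - (w - z) * (RtoC (a n) * (RtoC (INR n) * z ^ pred n)))%C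
    with (RtoC (a n) * (w ^ n - z ^ n - (w - z) * (RtoC (INR n) * z ^ pred n)))%C by ring.
  rewrite Cmod_mult, Cmod_R.
  pose proof (pow_taylor w z rho n Hrho Hw Hz) as Hp.
  eapply Rle_trans; [apply Rmult_le_compat_l; [apply Rabs_pos|exact Hp]|].
  right. simpl. ring.
Qed.

(** Stated over a general [K] in order to cover derivatives over [C] as well as those of the real
    functions in [is_derive_ray]. *)
Lemma is_derive_quadratic {K : AbsRing} {V : NormedModule K} (f : K -> V) (x : K) (l : V) (M d : R) :
  0 < d ->
  (forall y : K, abs (minus y x) < d ->
     norm (minus (minus (f y) (f x)) (scal (minus y x) l)) <= M * abs (minus y x) ^ 2) ->
  is_derive f x l.
Proof.
  intros Hd HM. split; [apply is_linear_scal_l|].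
  intros x' Hx'. apply (is_filter_lim_locally_unique (V:=AbsRing_NormedModule K)) in Hx'. subst x'.
  intros eps. destruct eps as [e He]. simpl.
  assert (HM1 : 0 < Rabs M + 1) by (pose proof (Rabs_pos M); lra).
  assert (Hm : 0 < Rmin d (e / (Rabs M + 1))).
  { apply Rmin_glb_lt; auto. apply Rdiv_lt_0_compat; auto. }
  cut (forall y : K, abs (minus y x) < Rmin d (e / (Rabs M + 1)) ->
     norm (minus (minus (f y) (f x)) (scal (minus y x) l)) <= e * abs (minus y x)).
  { intros Hcut. apply (locally_le_locally_norm (V := AbsRing_NormedModule K)).
    exists (mkposreal _ Hm). exact Hcut. }
  intros y Hy.
  assert (H1 : abs (minus y x) < d) by (eapply Rlt_le_trans; [exact Hy|apply Rmin_l]).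
  assert (H2 : abs (minus y x) < e / (Rabs M + 1)) by (eapply Rlt_le_trans; [exact Hy|apply Rmin_r]).
  eapply Rle_trans; [apply HM; exact H1|].
  pose proof (abs_ge_0 (minus y x)) as Hp. pose proof (Rle_abs M).
  revert Hp H1 H2. generalize (abs (minus y x)) as q. intros q Hp H1 H2.
  assert (q * (Rabs M + 1) <= e).
  { apply Rlt_le. apply Rmult_lt_reg_r with (/ (Rabs M + 1)); [now apply Rinv_0_lt_compat|].
    rewrite Rmult_assoc, Rinv_r, Rmult_1_r by lra. exact H2. }
  apply Rle_trans with ((q * (Rabs M + 1)) * q); [|now apply Rmult_le_compat_r].
  assert (0 <= q * q) by now apply Rmult_le_pos.
  simpl. nra.
Qed.

Lemma is_derive_CPS (a : nat -> R) (z : C) :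
  entire a -> is_derive (K:=C_AbsRing) (V:=C_NormedModule) (CPS a) z (CPS (PS_derive a) z).
Proof.
  intros Ha. pose proof (Cmod_ge_0 z).
  destruct (CPS_taylor a (Cmod z + 1) Ha) as [M HM]; [lra|].
  apply (is_derive_quadratic (K:=C_AbsRing) (V:=C_NormedModule) _ _ _ M 1); [lra|].
  intros y Hy. change (Cmod (y - z)%C < 1) in Hy.
  change (Cmod (CPS a y - CPS a z - (y - z) * CPS (PS_derive a) z)%C <= M * Cmod (y - z)%C ^ 2).
  apply (HM y z); [|lra].
  replace y with ((y - z) + z)%C by ring.
  eapply Rle_trans; [apply Cmod_triangle|]. lra.
Qed.

(** The components along a ray are real functions of [s]; [CPS_taylor] at [s * z] and [t * z]
    differentiates them without a chain rule between [R] and [C]. *)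
Lemma is_derive_ray (a : nat -> R) (z : C) (t : R) :
  entire a ->
  is_derive (fun s => Re (CPS a (RtoC s * z)%C)) t (Re (z * CPS (PS_derive a) (RtoC t * z))%C) /\
  is_derive (fun s => Im (CPS a (RtoC s * z)%C)) t (Im (z * CPS (PS_derive a) (RtoC t * z))%C).
Proof.
  intros Ha. pose proof (Cmod_ge_0 z) as Hz. pose proof (Rabs_pos t) as Ht.
  destruct (CPS_taylor a ((Rabs t + 1) * Cmod z + 1) Ha) as [M HM]; [nra|].
  assert (Hb : forall s, Rabs (s - t) < 1 ->
    Cmod (CPS a (RtoC s * z) - CPS a (RtoC t * z) - RtoC (s - t) * (z * CPS (PS_derive a) (RtoC t * z)))%C
    <= M * Cmod z ^ 2 * Rabs (s - t) ^ 2).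
  { intros s Hs.
    replace (RtoC (s - t) * (z * CPS (PS_derive a) (RtoC t * z)))%C
      with ((RtoC s * z - RtoC t * z) * CPS (PS_derive a) (RtoC t * z))%C by (rewrite RtoC_minus; ring).
    eapply Rle_trans; [apply HM|].
    - rewrite Cmod_mult, Cmod_R. pose proof (Rabs_triang_inv s t). nra.
    - rewrite Cmod_mult, Cmod_R. nra.
    - replace (RtoC s * z - RtoC t * z)%C with (RtoC (s - t) * z)%C by (rewrite RtoC_minus; ring).
      rewrite Cmod_mult, Cmod_R. right. ring. }
  split; apply (is_derive_quadratic (K:=R_AbsRing) (V:=R_NormedModule) _ _ _ (M * Cmod z ^ 2) 1);
    try lra; intros s Hs; change (Rabs (s - t) < 1) in Hs.
  - eapply Rle_trans; [|apply Hb; exact Hs].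
    match goal with |- _ <= Cmod ?w => eapply Rle_trans; [|apply (re_le_Cmod w)] end.
    right. change (norm ?x) with (Rabs x). f_equal.
    change (Re (CPS a (RtoC s * z)%C) - Re (CPS a (RtoC t * z)%C) - (s - t) * Re (z * CPS (PS_derive a) (RtoC t * z))%C
      = Re (CPS a (RtoC s * z) - CPS a (RtoC t * z))%C - Re (RtoC (s - t) * (z * CPS (PS_derive a) (RtoC t * z)))%C).
    rewrite Re_scal. reflexivity.
  - eapply Rle_trans; [|apply Hb; exact Hs].
    match goal with |- _ <= Cmod ?w => eapply Rle_trans; [|apply (im_le_Cmod w)] end.
    right. change (norm ?x) with (Rabs x). f_equal.
    change (Im (CPS a (RtoC s * z)%C) - Im (CPS a (RtoC t * z)%C) - (s - t) * Im (z * CPS (PS_derive a) (RtoC t * z))%C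
      = Im (CPS a (RtoC s * z) - CPS a (RtoC t * z))%C - Im (RtoC (s - t) * (z * CPS (PS_derive a) (RtoC t * z)))%C).
    rewrite Im_scal. reflexivity.
Qed.

(** * The minimum principle on disks *)

Lemma bcoef_log_derivative_C (mu X : R) (z : C) :
  -1 < mu -> (forall x, 0 <= x < X -> 0 < bfun mu x) -> Cmod z < X ->
  CPS (PS_derive (bcoef mu)) z = (- (CPS (riccati mu) z * CPS (bcoef mu) z))%C.
Proof.
  intros Hmu Hpos Hz.
  assert (Hh : CV_disk (riccati mu) (Cmod z)).
  { apply (riccati_disk mu X); auto. rewrite Rabs_pos_eq; auto using Cmod_ge_0. }
  assert (Ha : entire (bcoef mu)) by now apply bcoef_entire, regular_gt.
  rewrite <- CPS_mult by auto using entire_disk.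
  rewrite (CPS_ext (PS_mult (riccati mu) (bcoef mu)) (fun n => -1 * PS_derive (bcoef mu) n)).
  - rewrite CPS_scal by now apply entire_disk, entire_derive.
    change (RtoC (-1)) with (RtoC (Ropp 1)). rewrite RtoC_opp. ring.
  - intros n. rewrite bcoef_log_derivative by auto. ring.
Qed.

(** The complex identity at a real point: from here on [blog] is the sum of the series [riccati]
    inside [(-X, X)]. *)
Lemma bfun_log_derivative (mu X x : R) :
  -1 < mu -> (forall x, 0 <= x < X -> 0 < bfun mu x) -> Rabs x < X ->
  bfun' mu x = - (PSeries (riccati mu) x * bfun mu x).
Proof.
  intros Hmu Hpos Hx. apply RtoC_inj.
  pose proof (bcoef_log_derivative_C mu X (RtoC x) Hmu Hpos) as H.
  rewrite Cmod_R, !CPS_RtoC in H. unfold bfun, bfun'.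
  rewrite H by auto. now rewrite RtoC_opp, RtoC_mult.
Qed.

(* On the ray through [z], [|f (t z)|^2 / f (t |z|)^2] is nondecreasing in [t]. *)
Lemma bcoef_neq_0_disk (mu X : R) (z : C) :
  -1 < mu -> (forall x, 0 <= x < X -> 0 < bfun mu x) -> Cmod z < X ->
  CPS (bcoef mu) z <> RtoC 0.
Proof.
  intros Hmu Hpos Hz Hzero. pose proof (Cmod_ge_0 z) as Hr.
  assert (Hreg := regular_gt mu Hmu).
  set (r := Cmod z) in *.
  set (U := fun s : R => Re (CPS (bcoef mu) (RtoC s * z)%C)).
  set (V := fun s : R => Im (CPS (bcoef mu) (RtoC s * z)%C)).
  set (k := fun s : R => (z * CPS (riccati mu) (RtoC s * z))%C).
  assert (Hf : forall s, 0 <= s <= 1 -> 0 < bfun mu (s * r)).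
  { intros s Hs. apply Hpos. nra. }
  set (Q := fun s => (U s * U s + V s * V s) / (bfun mu (s * r) * bfun mu (s * r))).
  (* By [f' = - h f], the logarithmic derivative of the numerator of [Q] is [-2 * Re (k s)] and that
     of the denominator is [-2 * r * h (s * r)]. A zero of [f] at [z] would give
     [Q 1 = 0 < 1 = Q 0]. *)
  set (Q' := fun s => 2 * Q s * (r * PSeries (riccati mu) (s * r) - Re (k s))).
  destruct (MVT_cor2 Q Q' 0 1) as [c [Hc1 Hc2]]; [lra| |].
  - intros s Hs. apply is_derive_Reals.
    destruct (is_derive_ray (bcoef mu) z s (bcoef_entire mu Hreg)) as [DU DV].
    fold U in DU. fold V in DV.
    assert (Hsz : Cmod (RtoC s * z)%C < X).
    { rewrite Cmod_mult, Cmod_R, Rabs_pos_eq by lra. fold r. nra. }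
    rewrite (bcoef_log_derivative_C mu X _ Hmu Hpos Hsz) in DU, DV.
    set (w := CPS (bcoef mu) (RtoC s * z)%C) in *.
    replace (z * - (CPS (riccati mu) (RtoC s * z) * w))%C with (- (k s * w))%C in DU, DV by (unfold k; ring).
    change (Re (- (k s * w))%C) with (- (Re (k s) * U s - Im (k s) * V s)) in DU.
    change (Im (- (k s * w))%C) with (- (Re (k s) * V s + Im (k s) * U s)) in DV.
    assert (Df : is_derive (fun s => bfun mu (s * r)) s (r * (- (PSeries (riccati mu) (s * r) * bfun mu (s * r))))).
    { rewrite <- (bfun_log_derivative mu X) by (auto; rewrite Rabs_pos_eq; nra).
      evar_last.
      - apply (is_derive_comp (bfun mu) (fun s => s * r)); [now apply is_derive_bfun|].
        apply (is_derive_scal_l (K:=R_AbsRing) (V:=R_NormedModule)). apply is_derive_id.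
      - unfold scal, one; simpl. unfold mult; simpl. ring. }
    assert (Hfs := Hf s Hs).
    evar_last.
    { apply (is_derive_div (fun s => U s * U s + V s * V s) (fun s => bfun mu (s * r) * bfun mu (s * r))).
      - apply (is_derive_plus (K:=R_AbsRing) (V:=R_NormedModule)); apply (is_derive_mult (K:=R_AbsRing)).
        + exact DU.
        + exact DU.
        + intros; apply Rmult_comm.
        + exact DV.
        + exact DV.
        + intros; apply Rmult_comm.
      - apply (is_derive_mult (K:=R_AbsRing)); [exact Df|exact Df|intros; apply Rmult_comm].
      - nra. }
    unfold Q', Q, plus, mult; simpl. field. lra.
  - assert (Hpc : 0 <= Q' c).
    { unfold Q'. assert (0 <= Q c).
      { unfold Q. assert (0 < bfun mu (c * r)) by (apply Hf; lra).
        apply Rdiv_le_0_compat; nra. }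
      apply Rmult_le_pos; [lra|].
      assert (Hcz : Cmod (RtoC c * z)%C = c * r).
      { rewrite Cmod_mult, Cmod_R, Rabs_pos_eq by lra. reflexivity. }
      pose proof (Re_CPS_le (riccati mu) (RtoC c * z)%C) as Hre.
      rewrite Hcz in Hre.
      replace (RtoC c * z * CPS (riccati mu) (RtoC c * z))%C with (RtoC c * k c)%C in Hre by (unfold k; ring).
      rewrite Re_scal in Hre.
      assert (c * Re (k c) <= c * r * PSeries (riccati mu) (c * r)).
      { apply Hre.
        - intros n. now apply Rlt_le, riccati_pos.
        - apply (riccati_disk mu X); auto. rewrite Rabs_pos_eq; nra. }
      (* [Re_CPS_le] at [c * z] carries a factor [c], positive because the mean value point is
         interior. *)
      apply Rmult_le_reg_l with c; [lra|]. lra. }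
    assert (Q0 : Q 0 = 1).
    { unfold Q, U, V. replace (RtoC 0 * z)%C with (RtoC 0) by ring.
      rewrite CPS_RtoC, Rmult_0_l. fold (bfun mu 0). rewrite bfun_0. unfold Re, Im, RtoC. simpl. rewrite Rmult_0_l, bfun_0. field. }
    assert (Q1 : Q 1 = 0).
    { unfold Q, U, V. replace (RtoC 1 * z)%C with z by ring. rewrite Hzero.
      unfold Re, Im, RtoC, Rdiv. simpl. ring. }
    lra.
Qed.

Lemma Re_log_derivative_ge (mu X : R) (z : C) :
  -1 < mu -> (forall x, 0 <= x < X -> 0 < bfun mu x) -> Cmod z < X ->
  Cmod z * bfun' mu (Cmod z) / bfun mu (Cmod z)
  <= Re (z * CPS (PS_derive (bcoef mu)) z / CPS (bcoef mu) z)%C.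
Proof.
  intros Hmu Hpos Hz. pose proof (Cmod_ge_0 z) as Hr.
  assert (Hnz := bcoef_neq_0_disk mu X z Hmu Hpos Hz).
  assert (Hp : 0 < bfun mu (Cmod z)) by (apply Hpos; lra).
  rewrite (bcoef_log_derivative_C mu X z Hmu Hpos Hz).
  rewrite (bfun_log_derivative mu X (Cmod z) Hmu Hpos) by (rewrite Rabs_pos_eq; auto).
  replace (z * - (CPS (riccati mu) z * CPS (bcoef mu) z) / CPS (bcoef mu) z)%C
    with (- (z * CPS (riccati mu) z))%C by (field; auto).
  replace (Cmod z * - (PSeries (riccati mu) (Cmod z) * bfun mu (Cmod z)) / bfun mu (Cmod z))
    with (- (Cmod z * PSeries (riccati mu) (Cmod z))) by (field; lra).
  change (Re (- (z * CPS (riccati mu) z))%C) with (- Re (z * CPS (riccati mu) z)%C).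
  apply Ropp_le_contravar, Re_CPS_le.
  - intros n. now apply Rlt_le, riccati_pos.
  - apply (riccati_disk mu X); auto. rewrite Rabs_pos_eq; auto.
Qed.

(** * Euler's integral *)

(** For positive [f] the integral grows with the interval, so the improper integral is the supremum
    over compact intervals; it is at least the integral over [[1, 2]]. *)
Lemma is_RInt_gen_bounded (f : R -> R) (M : R) :
  (forall t, 0 < t -> continuous f t) -> (forall t, 0 < t -> 0 < f t) ->
  (forall a b, 0 < a < b -> RInt f a b <= M) ->
  exists l, 0 < l /\ is_RInt_gen f (at_right 0) (Rbar_locally p_infty) l.
Proof.
  intros Hc Hp HM.
  assert (Hex : forall a b, 0 < a -> 0 < b -> ex_RInt f a b).
  { intros a b Ha Hb. apply (ex_RInt_continuous (V:=R_CompleteNormedModule)). intros z Hz. apply Hc.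
    apply Rlt_le_trans with (Rmin a b); [now apply Rmin_glb_lt|lra]. }
  assert (Hmono : forall a a0 b0 b, 0 < a <= a0 -> a0 < b0 <= b -> RInt f a0 b0 <= RInt f a b).
  { intros a a0 b0 b Ha Hb.
    assert (Hpos : forall u v, 0 < u <= v -> 0 <= RInt f u v).
    { intros u v Huv. apply RInt_ge_0; [lra|apply Hex; lra|]. intros t Ht. apply Rlt_le, Hp. lra. }
    rewrite <- (RInt_Chasles f a a0 b) by (apply Hex; lra).
    rewrite <- (RInt_Chasles f a0 b0 b) by (apply Hex; lra).
    pose proof (Hpos a a0 Ha). pose proof (Hpos b0 b ltac:(lra)).
    unfold plus; simpl. lra. }
  destruct (completeness (fun v => exists a b, 0 < a < b /\ v = RInt f a b)) as [l [Hub Hlub]].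
  { exists M. intros v [a [b [Hab ->]]]. now apply HM. }
  { exists (RInt f 1 2), 1, 2. split; [lra|reflexivity]. }
  exists l. split.
  - apply Rlt_le_trans with (RInt f 1 2).
    + apply RInt_gt_0; [lra| |]; intros t Ht; [apply Hp|apply Hc]; lra.
    + apply Hub. exists 1, 2. split; [lra|reflexivity].
  - intros P [eps HP].
    assert (Hnear : exists a b, 0 < a < b /\ l - eps < RInt f a b).
    { destruct (Classical_Prop.classic (exists a b, 0 < a < b /\ l - eps < RInt f a b)) as [|Hno]; auto.
      exfalso. destruct eps as [e He]; simpl in *.
      assert (l <= l - e); [|lra]. apply Hlub. intros v [a [b [Hab ->]]].
      destruct (Rle_lt_dec (RInt f a b) (l - e)); auto. exfalso. apply Hno. exists a, b. auto. }
    destruct Hnear as [a0 [b0 [Hab Hlt]]].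
    apply Filter_prod with (fun a => 0 < a < a0) (fun b => b0 < b).
    + exists (mkposreal a0 (proj1 Hab)). intros y Hy Hy0.
      change (Rabs (y - 0) < a0) in Hy. rewrite Rminus_0_r, Rabs_pos_eq in Hy; lra.
    + exists b0. auto.
    + intros a b Ha Hb. exists (RInt f a b). simpl. split.
      * apply (RInt_correct f), Hex; lra.
      * apply HP. change (Rabs (RInt f a b - l) < eps).
        assert (RInt f a b <= l) by (apply Hub; exists a, b; split; [lra|reflexivity]).
        pose proof (Hmono a a0 b0 b ltac:(lra) ltac:(lra)).
        rewrite Rabs_left1; lra.
Qed.

Definition euler_kernel (x t : R) : R := Rpower t (x - 1) * exp (- t).

Lemma is_derive_Rpower (y t : R) : 0 < t -> is_derive (fun s => Rpower s y) t (y * Rpower t (y - 1)).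
Proof. intros Ht. now apply is_derive_Reals, derivable_pt_lim_power. Qed.

Lemma is_derive_exp_neg (t : R) : is_derive (fun s => exp (- s)) t (- exp (- t)).
Proof. auto_derive; auto. ring. Qed.

Lemma continuous_euler_kernel (x t : R) : 0 < t -> continuous (euler_kernel x) t.
Proof.
  intros Ht. apply continuity_pt_filterlim.
  apply (continuity_pt_mult (fun t => Rpower t (x - 1)) (fun t => exp (- t)));
    apply derivable_continuous_pt; eexists; apply is_derive_Reals.
  - now apply is_derive_Rpower.
  - apply is_derive_exp_neg.
Qed.

(** The right side is the maximum of the left one, attained at [t = 2 * x]; with [u = t / (2 * x)]
    the claim is [ln u <= u - 1]. *)
Lemma Rpower_exp_bound (x t : R) :
  0 < x -> 0 < t -> Rpower t x * exp (- t / 2) <= exp (x * ln (2 * x) - x).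
Proof.
  intros Hx Ht. unfold Rpower. rewrite <- exp_plus.
  set (u := t / (2 * x)).
  assert (Hu : 0 < u) by (apply Rdiv_lt_0_compat; lra).
  assert (H : ln u <= u - 1).
  { pose proof (exp_ineq1_le (ln u)) as H. rewrite exp_ln in H by auto. lra. }
  assert (E : t = u * (2 * x)) by (unfold u; field; lra).
  rewrite E, ln_mult by lra.
  destruct (Req_dec (x * (ln u + ln (2 * x)) + - (u * (2 * x)) / 2) (x * ln (2 * x) - x)) as [->|Hne]; [lra|].
  left. apply exp_increasing. nra.
Qed.

Lemma euler_kernel_RInt_bound (x : R) :
  0 < x -> exists M, forall a b, 0 < a < b -> RInt (euler_kernel x) a b <= M.
Proof.
  intros Hx. set (K := exp (x * ln (2 * x) - x)).
  (* [W'] dominates the kernel because [((1 + t ^ x) * exp (- t / 2)) ^ 2 <= (1 + K) ^ 2 = C * x].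
     Its primitive [W] lies between [- C] and 0, so both ends of the half-line are handled at
     once. *)
  set (C := (1 + K) ^ 2 / x).
  assert (HK : 0 < K) by apply exp_pos.
  assert (HC : 0 < C) by (apply Rdiv_lt_0_compat; [apply pow_lt; lra|auto]).
  exists C. intros a b Hab.
  set (W := fun t => - C / (1 + Rpower t x)).
  set (W' := fun t => C * (x * Rpower t (x - 1)) / (1 + Rpower t x) ^ 2).
  assert (Hr : forall t y, 0 < Rpower t y) by (intros; apply exp_pos).
  assert (DW : forall t, 0 < t -> is_derive W t (W' t)).
  { intros t Ht. unfold W, W'. pose proof (Hr t x). evar_last.
    - apply (is_derive_div (fun _ => - C) (fun t => 1 + Rpower t x)).
      + apply (is_derive_const (K:=R_AbsRing) (V:=R_NormedModule)).
      + apply (is_derive_plus (K:=R_AbsRing) (V:=R_NormedModule)).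
        * apply (is_derive_const (K:=R_AbsRing) (V:=R_NormedModule)).
        * now apply is_derive_Rpower.
      + lra.
    - unfold zero, plus; simpl. field. lra. }
  assert (IW : is_RInt W' a b (minus (W b) (W a))).
  { apply (is_RInt_derive (V:=R_CompleteNormedModule) W W').
    - intros t Ht. apply DW. rewrite Rmin_left in Ht; lra.
    - intros t Ht. rewrite Rmin_left in Ht by lra.
      apply continuity_pt_filterlim. unfold W'. pose proof (Hr t x).
      apply (continuity_pt_div (fun t => C * (x * Rpower t (x - 1))) (fun t => (1 + Rpower t x) ^ 2)).
      + apply derivable_continuous_pt. eexists. apply is_derive_Reals.
        apply is_derive_scal, is_derive_scal, is_derive_Rpower. lra.
      + apply derivable_continuous_pt. eexists. apply is_derive_Reals.
        apply is_derive_pow. apply (is_derive_plus (K:=R_AbsRing) (V:=R_NormedModule)).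
        * apply (is_derive_const (K:=R_AbsRing) (V:=R_NormedModule)).
        * apply is_derive_Rpower. lra.
      + apply pow_nonzero. lra. }
  apply Rle_trans with (RInt W' a b).
  - apply RInt_le; [lra| |eexists; exact IW|].
    + apply (ex_RInt_continuous (V:=R_CompleteNormedModule)). intros t Ht.
      apply continuous_euler_kernel. rewrite Rmin_left in Ht; lra.
    + intros t Ht. unfold euler_kernel, W', C. pose proof (Hr t x). pose proof (Hr t (x - 1)).
      assert (Hb : (1 + Rpower t x) * exp (- t / 2) <= 1 + K).
      { rewrite Rmult_plus_distr_r, Rmult_1_l. apply Rplus_le_compat.
        - rewrite <- exp_0. left. apply exp_increasing. lra.
        - apply Rpower_exp_bound; lra. }
      pose proof (exp_pos (- t / 2)).
      assert (Hb2 : ((1 + Rpower t x) * exp (- t / 2)) ^ 2 <= (1 + K) ^ 2).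
      { apply pow_incr. split; [apply Rmult_le_pos; lra|auto]. }
      replace (exp (- t)) with (exp (- t / 2) ^ 2) by (simpl; rewrite Rmult_1_r, <- exp_plus; f_equal; field).
      replace ((1 + K) ^ 2 / x * (x * Rpower t (x - 1)) / (1 + Rpower t x) ^ 2)
        with (Rpower t (x - 1) * ((1 + K) ^ 2 / (1 + Rpower t x) ^ 2)) by (field; split; lra).
      apply Rmult_le_compat_l; [lra|].
      apply Rmult_le_reg_r with ((1 + Rpower t x) ^ 2); [apply pow_lt; lra|].
      replace ((1 + K) ^ 2 / (1 + Rpower t x) ^ 2 * (1 + Rpower t x) ^ 2) with ((1 + K) ^ 2) by (field; lra).
      rewrite Rpow_mult_distr in Hb2. lra.
  - rewrite (is_RInt_unique _ _ _ _ IW). change (W b - W a <= C). unfold W.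
    pose proof (Hr a x). pose proof (Hr b x).
    assert (0 <= C / (1 + Rpower b x)) by (apply Rlt_le, Rdiv_lt_0_compat; lra).
    assert (C / (1 + Rpower a x) <= C).
    { apply Rmult_le_reg_r with (1 + Rpower a x); [lra|].
      unfold Rdiv. rewrite Rmult_assoc, Rinv_l by lra. nra. }
    unfold Rdiv in *. lra.
Qed.

Lemma euler_integral_correct (x : R) :
  0 < x -> 0 < euler_integral x /\
  is_RInt_gen (euler_kernel x) (at_right 0) (Rbar_locally p_infty) (euler_integral x).
Proof.
  intros Hx. destruct (euler_kernel_RInt_bound x Hx) as [M HM].
  destruct (is_RInt_gen_bounded (euler_kernel x) M) as [l [Hl1 Hl2]]; auto.
  - intros t Ht. now apply continuous_euler_kernel.
  - intros t Ht. apply Rmult_lt_0_compat; apply exp_pos.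
  - assert (E : euler_integral x = l) by (apply is_RInt_gen_unique; exact Hl2).
    rewrite E. auto.
Qed.

(** Integration by parts: [F] vanishes at both ends, and [F'] is the difference of the two
    integrands. *)
Lemma euler_integral_S (x : R) : 0 < x -> euler_integral (x + 1) = x * euler_integral x.
Proof.
  intros Hx.
  destruct (euler_integral_correct x Hx) as [_ I1].
  destruct (euler_integral_correct (x + 1) ltac:(lra)) as [_ I2].
  set (F := fun t => Rpower t x * exp (- t)).
  assert (DF : forall t, 0 < t -> is_derive F t (x * euler_kernel x t - euler_kernel (x + 1) t)).
  { intros t Ht. unfold F, euler_kernel. replace (x + 1 - 1) with x by ring. evar_last.
    - apply (is_derive_mult (fun t => Rpower t x) (fun t => exp (- t))).
      + now apply is_derive_Rpower.
      + apply is_derive_exp_neg.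
      + intros; apply Rmult_comm.
    - unfold plus, mult; simpl. ring. }
  assert (Hprod : forall P : R * R -> Prop, (forall a b, 0 < a -> 0 < b -> P (a, b)) ->
            filter_prod (at_right 0) (Rbar_locally p_infty) P).
  { intros P HP. apply Filter_prod with (fun a => 0 < a) (fun b => 0 < b); auto.
    - exists (mkposreal 1 Rlt_0_1). auto.
    - exists 0. auto. }
  assert (Hmin : forall a b t, 0 < a -> 0 < b -> Rmin a b <= t -> 0 < t).
  { intros a b t Ha Hb Ht. apply Rlt_le_trans with (Rmin a b); auto. now apply Rmin_glb_lt. }
  set (K := exp (x * ln (2 * x) - x)).
  assert (HK : 0 < K) by apply exp_pos.
  assert (HF : forall t, 0 < t -> 0 < F t) by (intros; apply Rmult_lt_0_compat; apply exp_pos).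
  assert (I3 : is_RInt_gen (Derive F) (at_right 0) (Rbar_locally p_infty) (0 - 0)).
  { apply is_RInt_gen_Derive.
    - apply Hprod. simpl. intros a b Ha Hb t Ht. eexists. apply DF. apply (Hmin a b); lra.
    - apply Hprod. simpl. intros a b Ha Hb t Ht.
      assert (Ht0 : 0 < t) by (apply (Hmin a b); lra).
      apply (continuous_ext_loc _ (fun t => x * euler_kernel x t - euler_kernel (x + 1) t)).
      + exists (mkposreal t Ht0). intros y Hy. change (Rabs (y - t) < t) in Hy.
        apply Rabs_def2 in Hy. symmetry. apply is_derive_unique, DF. lra.
      + apply (continuous_minus (V:=R_NormedModule)); [|now apply continuous_euler_kernel].
        apply (continuous_scal_r (V:=R_NormedModule) x), continuous_euler_kernel, Ht0.
    (* Near 0, [F t <= t ^ x], and the threshold is [eps ^ (1 / x)]. *)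
    - intros P [eps HP]. exists (mkposreal (exp (ln eps / x)) (exp_pos _)).
      intros t Ht Ht0. apply HP. change (Rabs (F t - 0) < eps).
      change (Rabs (t - 0) < exp (ln eps / x)) in Ht. rewrite Rminus_0_r in *.
      rewrite Rabs_pos_eq in Ht by lra. rewrite Rabs_pos_eq by (apply Rlt_le, HF, Ht0).
      apply ln_increasing in Ht; auto. rewrite ln_exp in Ht.
      apply Rle_lt_trans with (Rpower t x).
      + unfold F. rewrite <- (Rmult_1_r (Rpower t x)) at 2.
        apply Rmult_le_compat_l; [apply Rlt_le, exp_pos|].
        rewrite <- exp_0. left. apply exp_increasing. lra.
      + rewrite <- (exp_ln eps) by apply cond_pos. unfold Rpower. apply exp_increasing.
        apply Rmult_lt_reg_r with (/ x); [now apply Rinv_0_lt_compat|].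
        replace (x * ln t * / x) with (ln t) by (field; lra). exact Ht.
    (* At infinity, [F t <= K * exp (- t / 2) < 2 * K / t]. *)
    - intros P [eps HP]. exists (2 * K / eps). intros t Ht. apply HP.
      change (Rabs (F t - 0) < eps). rewrite Rminus_0_r.
      assert (He : 0 < eps) by apply cond_pos.
      assert (Ht0 : 0 < t).
      { apply Rlt_trans with (2 * K / eps); auto. apply Rdiv_lt_0_compat; lra. }
      rewrite Rabs_pos_eq by (apply Rlt_le, HF, Ht0).
      unfold F. replace (- t) with (- t / 2 + - t / 2) by field. rewrite exp_plus.
      pose proof (Rpower_exp_bound x t Hx Ht0) as Hb. fold K in Hb.
      assert (He2 : exp (- t / 2) * (t / 2) < 1).
      { replace (- t / 2) with (- (t / 2)) by field. rewrite exp_Ropp.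
        pose proof (exp_ineq1_le (t / 2)). pose proof (exp_pos (t / 2)).
        apply Rmult_lt_reg_l with (exp (t / 2)); auto.
        rewrite <- Rmult_assoc, Rinv_r by lra. lra. }
      assert (He3 : 2 * K < eps * t).
      { apply Rmult_lt_reg_r with (/ eps); [now apply Rinv_0_lt_compat|].
        replace (eps * t * / eps) with t by (field; lra). exact Ht. }
      rewrite <- Rmult_assoc. pose proof (exp_pos (- t / 2)).
      apply Rle_lt_trans with (K * exp (- t / 2)); [apply Rmult_le_compat_r; lra|].
      nra. }
  assert (I4 := is_RInt_gen_minus _ _ _ _ (is_RInt_gen_scal _ x _ I1) I2).
  assert (I5 : is_RInt_gen (Derive F) (at_right 0) (Rbar_locally p_infty)
                 (minus (scal x (euler_integral x)) (euler_integral (x + 1)))).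
  { eapply is_RInt_gen_ext; [|exact I4]. apply Hprod. simpl. intros a b Ha Hb t Ht.
    symmetry. apply is_derive_unique, DF, (Hmin a b); lra. }
  assert (E1 := is_RInt_gen_unique _ _ I3). assert (E2 := is_RInt_gen_unique _ _ I5).
  rewrite E1 in E2. unfold minus, plus, opp, scal in E2; simpl in E2. unfold mult in E2; simpl in E2. lra.
Qed.

(** * The Gamma function at arguments above -1 *)

Lemma up_unique (r : R) (k : Z) : IZR k - 1 <= r < IZR k -> up r = k.
Proof.
  intros Hk. symmetry. apply tech_up; lra.
Qed.

Lemma Gamma_pos_arg (x : R) : 0 < x -> Gamma x = euler_integral x.
Proof.
  intros Hx. unfold Gamma.
  assert (E : gamma_shift x = O).
  { unfold gamma_shift. destruct (archimed (- x)) as [H1 H2].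
    (* Thus [up (- x)] is at most 0, and [Z.to_nat] sends it to 0. *)
    assert (IZR (up (- x)) < 1) by lra. apply lt_IZR in H.
    destruct (up (- x)); simpl; auto; lia. }
  rewrite E. simpl. rewrite Rplus_0_r. field.
Qed.

(** The arguments that occur exceed -1, so a single step of the continuation suffices. *)
Lemma Gamma_neg_arg (x : R) : -1 < x < 0 -> Gamma x = euler_integral (x + 1) / x.
Proof.
  intros Hx. unfold Gamma.
  assert (E : gamma_shift x = 1%nat).
  { unfold gamma_shift. rewrite (up_unique (- x) 1); [reflexivity|lra]. }
  rewrite E. simpl. rewrite Rplus_0_r, Rmult_1_l. reflexivity.
Qed.

Lemma Gamma_neq_0 (x : R) : -1 < x -> x <> 0 -> Gamma x <> 0.
Proof.
  intros H1 H0. destruct (Rlt_le_dec 0 x) as [Hx|Hx].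
  - rewrite Gamma_pos_arg by auto. apply Rgt_not_eq, (euler_integral_correct x Hx).
  - rewrite Gamma_neg_arg by lra.
    destruct (euler_integral_correct (x + 1) ltac:(lra)) as [Hp _].
    unfold Rdiv. apply Rmult_integral_contrapositive_currified; [lra|now apply Rinv_neq_0_compat].
Qed.

Lemma Gamma_S (x : R) : -1 < x -> x <> 0 -> Gamma (x + 1) = x * Gamma x.
Proof.
  intros H1 H0. rewrite Gamma_pos_arg by lra. destruct (Rlt_le_dec 0 x) as [Hx|Hx].
  - rewrite Gamma_pos_arg by auto. now apply euler_integral_S.
  - rewrite Gamma_neg_arg by lra. field. lra.
Qed.

(** * Complex powers and Bessel functions *)

Definition cis (t : R) : C := (cos t, sin t).

Lemma cis_0 : cis 0 = RtoC 1.
Proof. unfold cis. now rewrite cos_0, sin_0. Qed.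

Lemma cis_plus (s t : R) : cis (s + t) = (cis s * cis t)%C.
Proof.
  unfold cis, Cmult. simpl. rewrite cos_plus, sin_plus. f_equal. ring.
Qed.

Lemma Cmod_cis (t : R) : Cmod (cis t) = 1.
Proof.
  unfold Cmod, cis. simpl. rewrite !Rmult_1_r.
  pose proof (sin2_cos2 t) as H. unfold Rsqr in H.
  replace (cos t * cos t + sin t * sin t) with 1 by lra. apply sqrt_1.
Qed.

Lemma Cmod_polar (rho t : R) : 0 < rho -> Cmod (RtoC rho * cis t)%C = rho.
Proof.
  intros H. rewrite Cmod_mult, Cmod_R, Cmod_cis, Rabs_pos_eq; lra.
Qed.

Lemma polar_neq_0 (rho t : R) : 0 < rho -> (RtoC rho * cis t)%C <> RtoC 0.
Proof.
  intros H. apply Cmod_gt_0. now rewrite Cmod_polar.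
Qed.

Lemma Carg_polar (rho t : R) : 0 < rho -> - PI < t <= PI -> Carg (RtoC rho * cis t)%C = t.
Proof.
  intros Hrho Ht. unfold Carg. rewrite Cmod_polar, Re_scal, Im_scal by auto.
  change (Re (cis t)) with (cos t). change (Im (cis t)) with (sin t).
  replace (rho * cos t / rho) with (cos t) by (field; lra).
  destruct (Rle_dec 0 (rho * sin t)) as [Hs|Hs].
  - destruct (Rlt_le_dec t 0) as [Hn|Hn]; [|apply acos_cos; lra].
    exfalso. assert (sin t < 0) by (apply sin_lt_0_var; lra). nra.
  - destruct (Rlt_le_dec t 0) as [Hn|Hn].
    + rewrite <- cos_neg, acos_cos by lra. ring.
    + exfalso. apply Hs. apply Rmult_le_pos; [lra|apply sin_ge_0; lra].
Qed.

Lemma Re_div_Cmod_bound (z : C) : z <> RtoC 0 -> -1 <= Re z / Cmod z <= 1.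
Proof.
  intros Hz. apply Cmod_gt_0 in Hz. pose proof (re_le_Cmod z) as H.
  apply Rabs_le_between in H. split.
  - apply Rmult_le_reg_r with (Cmod z); auto.
    replace (Re z / Cmod z * Cmod z) with (Re z) by (field; lra). lra.
  - apply Rmult_le_reg_r with (Cmod z); auto.
    replace (Re z / Cmod z * Cmod z) with (Re z) by (field; lra). lra.
Qed.

Lemma Carg_bound (z : C) : z <> RtoC 0 -> - PI < Carg z <= PI.
Proof.
  intros Hz. unfold Carg. pose proof PI_RGT_0.
  pose proof (acos_bound (Re z / Cmod z)) as Hb.
  destruct (Rle_dec 0 (Im z)) as [|Hi]; [lra|].
  (* An angle [- PI] would force [Re z = - Cmod z], hence [Im z = 0], which belongs to the other
     branch. *)
  split; [|lra]. destruct (Req_dec (acos (Re z / Cmod z)) PI) as [E|]; [|lra].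
  exfalso. apply Hi. right.
  assert (Hc : cos (acos (Re z / Cmod z)) = Re z / Cmod z) by now apply cos_acos, Re_div_Cmod_bound.
  rewrite E, cos_PI in Hc.
  apply Cmod_gt_0 in Hz. pose proof (Cmod2_alt z) as H2.
  assert (Re z = - Cmod z).
  { replace (Re z) with (Re z / Cmod z * Cmod z) by (field; lra). rewrite <- Hc. ring. }
  rewrite H0 in H2. assert (Im z * Im z = 0) by nra.
  symmetry. now apply Rsqr_0_uniq.
Qed.

Lemma polar_form (z : C) : z <> RtoC 0 -> z = (RtoC (Cmod z) * cis (Carg z))%C.
Proof.
  intros Hz. assert (Hm := Hz). apply Cmod_gt_0 in Hm.
  set (c := acos (Re z / Cmod z)).
  assert (Hc : cos c = Re z / Cmod z) by now apply cos_acos, Re_div_Cmod_bound.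
  assert (Hs0 : 0 <= sin c) by (apply sin_ge_0; apply acos_bound).
  assert (Hs : Cmod z * sin c = Rabs (Im z)).
  { apply Rsqr_inj; [apply Rmult_le_pos; lra|apply Rabs_pos|].
    rewrite <- Rsqr_abs. rewrite Rsqr_mult.
    pose proof (sin2_cos2 c) as H. replace (Rsqr (sin c)) with (1 - Rsqr (cos c)) by lra.
    rewrite Hc. pose proof (Cmod2_alt z) as H2. unfold Rsqr.
    replace (Cmod z * Cmod z * (1 - Re z / Cmod z * (Re z / Cmod z))) with (Cmod z ^ 2 - Re z * Re z) by (field; lra).
    rewrite H2. ring. }
  assert (E : (RtoC (Cmod z) * cis (Carg z))%C = (Cmod z * cos (Carg z), Cmod z * sin (Carg z))).
  { unfold Cmult, RtoC, cis. simpl. f_equal; ring. }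
  rewrite E. rewrite (surjective_pairing z) at 1. fold (Re z) (Im z).
  unfold Carg. fold c. destruct (Rle_dec 0 (Im z)) as [Hi|Hi].
  - rewrite Hs, Hc, Rabs_pos_eq by auto. f_equal. field. lra.
  - rewrite cos_neg, sin_neg. rewrite Ropp_mult_distr_r_reverse, Hs, Hc, Rabs_left by lra.
    f_equal; [field; lra|ring].
Qed.

Lemma Cpower_neq_0 (z : C) (a : R) :
  z <> RtoC 0 -> Cpower z a = (RtoC (Rpower (Cmod z) a) * cis (a * Carg z))%C.
Proof. intros Hz. unfold Cpower. destruct (Ceq_dec z 0) as [|]; [contradiction|reflexivity]. Qed.

Lemma Cpower_plus (z : C) (a b : R) :
  z <> RtoC 0 -> Cpower z (a + b) = (Cpower z a * Cpower z b)%C.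
Proof.
  intros Hz. rewrite !Cpower_neq_0 by auto.
  rewrite Rpower_plus, Rmult_plus_distr_r, cis_plus, RtoC_mult. ring.
Qed.

Lemma Cpower_1 (z : C) : z <> RtoC 0 -> Cpower z 1 = z.
Proof.
  intros Hz. rewrite Cpower_neq_0, Rpower_1, Rmult_1_l by (auto; now apply Cmod_gt_0).
  symmetry. now apply polar_form.
Qed.

Lemma Cpower_INR (z : C) (n : nat) : z <> RtoC 0 -> Cpower z (INR n) = (z ^ n)%C.
Proof.
  intros Hz. induction n as [|n IH].
  - simpl INR. rewrite Cpower_neq_0, Rmult_0_l, cis_0, Rpower_O by (auto; now apply Cmod_gt_0).
    simpl. ring.
  - rewrite S_INR, Cpower_plus, IH, Cpower_1, Cpow_S by auto. ring.
Qed.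

Lemma Cpower_nonzero (z : C) (a : R) : z <> RtoC 0 -> Cpower z a <> RtoC 0.
Proof. intros Hz. rewrite Cpower_neq_0 by auto. apply polar_neq_0, exp_pos. Qed.

Lemma Cpower_pos_real (x a : R) : 0 < x -> Cpower (RtoC x) a = RtoC (Rpower x a).
Proof.
  intros Hx. assert (E : RtoC x = (RtoC x * cis 0)%C) by (rewrite cis_0; ring).
  assert (Hx0 : RtoC x <> RtoC 0) by (rewrite E; now apply polar_neq_0).
  rewrite Cpower_neq_0 by auto. pose proof PI_RGT_0.
  replace (Carg (RtoC x)) with 0 by (rewrite E, Carg_polar; lra).
  rewrite Rmult_0_r, cis_0, Cmod_R, Rabs_pos_eq by lra. ring.
Qed.

Lemma regular_nu (nu : R) : -2 < nu -> nu <> -1 -> regular nu.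
Proof.
  intros H2 H1 n. destruct n as [|n]; [simpl; lra|].
  rewrite S_INR. pose proof (pos_INR n). lra.
Qed.

Lemma Gamma_shifted (nu : R) (n : nat) :
  -2 < nu -> nu <> -1 ->
  Gamma (INR (S n) + nu + 1) = (INR n + nu + 1) * Gamma (INR n + nu + 1).
Proof.
  intros H2 H1. rewrite <- Gamma_S.
  - f_equal. rewrite S_INR. ring.
  - pose proof (pos_INR n). lra.
  - now apply regular_nu.
Qed.

(** The factor [4 ^ n] is cancelled by [(w / 2) ^ (2 * n)] in the series of [J_nu]. *)
Lemma bessel_coef (nu : R) (n : nat) :
  -2 < nu -> nu <> -1 ->
  (-1) ^ n / (INR (fact n) * Gamma (INR n + nu + 1)) = 4 ^ n * bcoef nu n / Gamma (nu + 1).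
Proof.
  intros H2 H1.
  assert (HG : forall k, Gamma (INR k + nu + 1) <> 0).
  { intros k. apply Gamma_neq_0; [pose proof (pos_INR k); lra|now apply regular_nu]. }
  assert (HG0 : Gamma (nu + 1) <> 0) by (apply Gamma_neq_0; lra).
  induction n as [|n IH].
  - simpl. rewrite Rplus_0_l. field. auto.
  - rewrite Gamma_shifted by auto.
    change (fact (S n)) with (S n * fact n)%nat. rewrite mult_INR, S_INR.
    pose proof (regular_nu nu H2 H1 n) as Hr. pose proof (HG n). pose proof (INR_fact_neq_0 n).
    pose proof (pos_INR n).
    transitivity (- ((-1) ^ n / (INR (fact n) * Gamma (INR n + nu + 1))) / ((INR n + 1) * (INR n + nu + 1))).
    + simpl. field. repeat split; auto; lra.
    + rewrite IH. simpl. field. repeat split; auto; lra.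
Qed.

Lemma BesselJ_CPS (nu : R) (w : C) :
  -2 < nu -> nu <> -1 -> w <> RtoC 0 ->
  BesselJ nu w = (Cpower (w / RtoC 2) nu * RtoC (/ Gamma (nu + 1)) * CPS (bcoef nu) (w ^ 2))%C.
Proof.
  intros H2 H1 Hw. unfold BesselJ. apply is_Cseries_unique.
  assert (Hc2 : RtoC 2 <> RtoC 0) by (intros E; apply RtoC_inj in E; lra).
  assert (Hw2 : (w / RtoC 2)%C <> RtoC 0).
  { intros E. apply Hw. replace w with (w / RtoC 2 * RtoC 2)%C by (field; auto). rewrite E. ring. }
  eapply is_Cseries_ext.
  2:{ apply is_Cseries_scal, CPS_correct, entire_disk, bcoef_entire, regular_nu; auto. }
  intros n. cbv beta. rewrite bessel_coef by auto.
  replace (2 * INR n + nu) with (nu + INR (2 * n)) by (rewrite mult_INR; simpl; ring).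
  rewrite Cpower_plus, Cpower_INR by auto.
  unfold Rdiv. rewrite !RtoC_mult, RtoC_pow.
  replace ((w / RtoC 2) ^ (2 * n))%C with ((/ RtoC 4) ^ n * (w ^ 2) ^ n)%C.
  2:{ rewrite <- Cpow_mult_l, Cpow_mult_r. f_equal. rewrite <- (Rmult_1_l 4).
      replace (1 * 4) with (2 * 2) by ring. rewrite RtoC_mult. simpl. field. }
  assert (E4 : (RtoC 4 ^ n * (/ RtoC 4) ^ n)%C = RtoC 1).
  { rewrite <- Cpow_mult_l, Cinv_r, Cpow_1_l; auto. intros E; apply RtoC_inj in E; lra. }
  transitivity (Cpower (w / RtoC 2) nu * RtoC (/ Gamma (nu + 1)) * (RtoC (bcoef nu n) * (w ^ 2) ^ n)
     * (RtoC 4 ^ n * (/ RtoC 4) ^ n))%C; [rewrite E4|]; ring.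
Qed.

Lemma BesselJ_pos (nu x : R) :
  -2 < nu -> nu <> -1 -> 0 < x ->
  BesselJ nu (RtoC x) = RtoC (Rpower (x / 2) nu / Gamma (nu + 1) * bfun nu (x ^ 2)).
Proof.
  intros H2 H1 Hx. rewrite BesselJ_CPS; auto.
  2:{ intros E; apply RtoC_inj in E; lra. }
  rewrite <- RtoC_div by lra. rewrite Cpower_pos_real by lra.
  rewrite <- RtoC_pow, CPS_RtoC. unfold Rdiv. now rewrite !RtoC_mult.
Qed.

(** The principal square root has argument [t / 2], still principal, so its power [nu] has angle
    [nu * t / 2], which cancels that of [z ^ (- nu / 2)] also across the cut. *)
Lemma phi_CPS (nu : R) (z : C) : -2 < nu -> nu <> -1 -> phi nu z = CPS (bcoef nu) z.
Proof.
  intros H2 H1. unfold phi. destruct (Ceq_dec z 0) as [->|Hz].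
  - rewrite CPS_RtoC. fold (bfun nu 0). now rewrite bfun_0.
  - pose proof (Carg_bound z Hz) as Hb. pose proof PI_RGT_0.
    assert (Hm := Hz). apply Cmod_gt_0 in Hm.
    set (m := Cmod z) in *. set (t := Carg z) in *.
    assert (Hs : Cpower z (1 / 2) <> RtoC 0) by now apply Cpower_nonzero.
    rewrite BesselJ_CPS by auto.
    replace (Cpower z (1 / 2) ^ 2)%C with z.
    2:{ rewrite <- (Cpower_1 z) at 1 by auto. replace 1 with (1 / 2 + 1 / 2) at 1 by field.
        rewrite Cpower_plus by auto. simpl. ring. }
    assert (Hp : 0 < Rpower m (1 / 2)) by apply exp_pos.
    assert (E : (Cpower z (1 / 2) / RtoC 2)%C = (RtoC (Rpower m (1 / 2) / 2) * cis (1 / 2 * t))%C).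
    { rewrite Cpower_neq_0 by auto. fold m t. rewrite RtoC_div by lra. field. }
    rewrite E, !Cpower_neq_0 by (auto; apply polar_neq_0; lra).
    fold m t. rewrite Cmod_polar, Carg_polar by lra.
    assert (E1 : (cis (- nu / 2 * t) * cis (nu * (1 / 2 * t)))%C = RtoC 1).
    { rewrite <- cis_plus, <- cis_0. f_equal. field. }
    assert (E2 : Rpower 2 nu * Gamma (nu + 1) * Rpower m (- nu / 2) * Rpower (Rpower m (1 / 2) / 2) nu * / Gamma (nu + 1) = 1).
    { replace (Rpower (Rpower m (1 / 2) / 2) nu) with (Rpower m (nu / 2) * Rpower 2 (- nu)).
      - transitivity (Rpower 2 (nu + - nu) * Rpower m (- nu / 2 + nu / 2)).
        + rewrite !Rpower_plus. field. apply Gamma_neq_0; lra.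
        + replace (nu + - nu) with 0 by ring. replace (- nu / 2 + nu / 2) with 0 by field.
          rewrite !Rpower_O by lra. ring.
      - unfold Rpower at 1 2 3. rewrite <- exp_plus. f_equal.
        rewrite ln_div by lra. unfold Rpower. rewrite ln_exp. field. }
    transitivity (RtoC (Rpower 2 nu * Gamma (nu + 1) * Rpower m (- nu / 2) * Rpower (Rpower m (1 / 2) / 2) nu * / Gamma (nu + 1))
       * (cis (- nu / 2 * t) * cis (nu * (1 / 2 * t))) * CPS (bcoef nu) z)%C.
    + rewrite !RtoC_mult. ring.
    + rewrite E1, E2. ring.
Qed.

(** * The radius of convexity *)

Lemma bcoef_derive (nu : R) (n : nat) :
  -2 < nu -> nu <> -1 ->
  PS_derive (bcoef nu) n = - / (4 * (nu + 1)) * bcoef (nu + 1) n.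
Proof.
  intros H2 H1. unfold PS_derive.
  induction n as [|n IH].
  - simpl. field. lra.
  - pose proof (pos_INR n). pose proof (regular_nu nu H2 H1 (S n)) as Hr.
    rewrite S_INR in Hr.
    transitivity (- (INR (S n) * bcoef nu (S n)) / (4 * (INR n + 1) * (INR n + 1 + nu + 1))).
    + change (bcoef nu (S (S n))) with (- bcoef nu (S n) / (4 * (INR (S n) + 1) * (INR (S n) + nu + 1))).
      generalize (bcoef nu (S n)) as b. intros b. rewrite !S_INR. field. repeat split; lra.
    + rewrite IH. simpl bcoef. generalize (bcoef (nu + 1) n) as b. intros b. field. repeat split; lra.
Qed.

Lemma bcoef_contiguous (nu : R) (n : nat) :
  -2 < nu -> nu <> -1 ->
  (nu + 1) * bcoef nu n = (nu + 1 + INR n) * bcoef (nu + 1) n.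
Proof.
  intros H2 H1. destruct n as [|n]; [simpl; ring|].
  pose proof (pos_INR n). pose proof (regular_nu nu H2 H1 (S n)) as Hr.
  rewrite S_INR in Hr.
  apply Rmult_eq_reg_l with (INR n + 1); [|lra].
  transitivity ((nu + 1) * PS_derive (bcoef nu) n); [unfold PS_derive; rewrite S_INR; ring|].
  rewrite bcoef_derive, S_INR by auto. simpl. field. repeat split; lra.
Qed.

(** The recurrence [w J_mu' + mu J_mu = w J_(mu-1)] for [mu = nu + 1], freed of its power and Gamma
    factors. *)
Lemma bfun_contiguous (nu x : R) :
  -2 < nu -> nu <> -1 ->
  (nu + 1) * bfun nu x = (nu + 1) * bfun (nu + 1) x + x * bfun' (nu + 1) x.
Proof.
  intros H2 H1. assert (Hr : regular (nu + 1)) by (apply regular_gt; lra).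
  unfold bfun, bfun'. rewrite <- !(PSeries_scal (nu + 1)), <- PSeries_incr_1, <- PSeries_plus.
  - apply PSeries_ext. intros n.
    transitivity ((nu + 1) * bcoef nu n); [reflexivity|].
    rewrite bcoef_contiguous by auto. unfold PS_plus, PS_scal, PS_incr_1, PS_derive.
    destruct n as [|n].
    + change ((nu + 1 + 0) * bcoef (nu + 1) 0 = (nu + 1) * bcoef (nu + 1) 0 + 0). ring.
    + change ((nu + 1 + INR (S n)) * bcoef (nu + 1) (S n)
        = (nu + 1) * bcoef (nu + 1) (S n) + INR (S n) * bcoef (nu + 1) (S n)). ring.
  - apply ex_pseries_scal; [apply Rmult_comm|]. now apply CV_radius_inside, entire_radius, bcoef_entire.
  - apply ex_pseries_incr_1. now apply CV_radius_inside, entire_radius, entire_derive, bcoef_entire.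
Qed.

(** The powers cancel and the Gamma factors leave [nu + 1], so the Bessel quotient is
    [(nu + 1) phi_nu / f]. Clearing [f] leaves a function continuous on the whole axis, to which
    [first_zero] applies. *)
Lemma convexity_equation_iff (nu alpha r : R) :
  -2 < nu -> nu <> -1 -> 0 < r -> bfun (nu + 1) r <> 0 ->
  (convexity_equation nu alpha r <-> r * bfun' (nu + 1) r + (1 - alpha) * bfun (nu + 1) r = 0).
Proof.
  intros H2 H1 Hr Hf.
  assert (Hx : 0 < sqrt r) by now apply sqrt_lt_R0.
  assert (Hxx : sqrt r ^ 2 = r) by (apply pow2_sqrt; lra).
  assert (HG : Gamma (nu + 1) <> 0) by (apply Gamma_neq_0; lra).
  assert (HP : 0 < Rpower (sqrt r / 2) nu) by apply exp_pos.
  unfold convexity_equation. rewrite !BesselJ_pos by lra.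
  rewrite Gamma_S, Rpower_plus, Rpower_1, Hxx by lra.
  set (A := Rpower (sqrt r / 2) nu / Gamma (nu + 1) * bfun nu r).
  set (B := Rpower (sqrt r / 2) nu * (sqrt r / 2) / ((nu + 1) * Gamma (nu + 1)) * bfun (nu + 1) r).
  assert (HB : B <> 0).
  { unfold B, Rdiv. repeat apply Rmult_integral_contrapositive_currified; try lra.
    apply Rinv_neq_0_compat, Rmult_integral_contrapositive_currified; lra. }
  assert (E : sqrt r * A / (2 * B) - nu = 1 + r * bfun' (nu + 1) r / bfun (nu + 1) r).
  { transitivity ((nu + 1) * bfun nu r / bfun (nu + 1) r - nu).
    - unfold A, B. field. repeat split; lra.
    - rewrite bfun_contiguous by auto. field. auto. }
  assert (EC : (RtoC (sqrt r) * RtoC A / (RtoC 2 * RtoC B) - RtoC nu)%C = RtoC (sqrt r * A / (2 * B) - nu)).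
  { rewrite RtoC_minus, RtoC_div, !RtoC_mult by (apply Rmult_integral_contrapositive_currified; lra).
    reflexivity. }
  rewrite EC, E. split.
  - intros [_ He]. apply RtoC_inj in He. rewrite <- He. field. auto.
  - intros He. split.
    + intros HB0. apply RtoC_inj in HB0. contradiction.
    + f_equal. replace (r * bfun' (nu + 1) r) with (- ((1 - alpha) * bfun (nu + 1) r)) by lra.
      field. auto.
Qed.

Lemma BesselJ_pos_zero_iff (mu x : R) :
  -1 < mu -> 0 < x -> (BesselJ mu (RtoC x) = RtoC 0 <-> bfun mu (x ^ 2) = 0).
Proof.
  intros Hmu Hx. rewrite BesselJ_pos by lra.
  assert (Hp : 0 < Rpower (x / 2) mu) by apply exp_pos.
  assert (HG : Gamma (mu + 1) <> 0) by (apply Gamma_neq_0; lra).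
  split.
  - intros E. apply RtoC_inj in E. apply Rmult_integral in E. destruct E as [E|]; auto.
    exfalso. revert E. unfold Rdiv. apply Rmult_integral_contrapositive_currified; [lra|].
    now apply Rinv_neq_0_compat.
  - intros ->. now rewrite Rmult_0_r.
Qed.

Lemma C_derive_phi (nu : R) :
  -2 < nu -> nu <> -1 -> C_derive (phi nu) = CPS (PS_derive (bcoef nu)).
Proof.
  intros H2 H1. assert (E : phi nu = CPS (bcoef nu)).
  { apply functional_extensionality. intros z. now apply phi_CPS. }
  rewrite E. apply functional_extensionality. intros z.
  apply is_C_derive_unique, is_derive_CPS, bcoef_entire, regular_nu; auto.
Qed.

Lemma convexity_quotient (nu : R) (z : C) :
  -2 < nu -> nu <> -1 -> CPS (bcoef (nu + 1)) z <> RtoC 0 ->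
  C_derive (phi nu) z <> RtoC 0 /\
  (1 + z * C_derive (C_derive (phi nu)) z / C_derive (phi nu) z
   = 1 + z * CPS (PS_derive (bcoef (nu + 1))) z / CPS (bcoef (nu + 1)) z)%C.
Proof.
  intros H2 H1 Hz.
  assert (Hr : regular nu) by now apply regular_nu.
  assert (Hr1 : regular (nu + 1)) by (apply regular_gt; lra).
  set (k := - / (4 * (nu + 1))).
  assert (Hk : RtoC k <> RtoC 0).
  { intros E. apply RtoC_inj in E. unfold k in E.
    assert (/ (4 * (nu + 1)) <> 0) by (apply Rinv_neq_0_compat; lra). lra. }
  assert (E1 : C_derive (phi nu) z = (RtoC k * CPS (bcoef (nu + 1)) z)%C).
  { rewrite C_derive_phi by auto.
    rewrite <- CPS_scal by now apply entire_disk, bcoef_entire.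
    apply CPS_ext. intros n. now apply bcoef_derive. }
  assert (E2 : C_derive (C_derive (phi nu)) z = (RtoC k * CPS (PS_derive (bcoef (nu + 1))) z)%C).
  { rewrite C_derive_phi by auto.
    transitivity (CPS (PS_derive (PS_derive (bcoef nu))) z).
    - apply is_C_derive_unique, is_derive_CPS, entire_derive, bcoef_entire; auto.
    - rewrite <- CPS_scal by now apply entire_disk, entire_derive, bcoef_entire.
      apply CPS_ext. intros n. unfold PS_derive at 1 3. rewrite bcoef_derive by auto.
      fold k. ring. }
  rewrite E1, E2. split.
  - intros E. apply Hz. replace (CPS (bcoef (nu + 1)) z) with (/ RtoC k * (RtoC k * CPS (bcoef (nu + 1)) z))%C by (field; auto).
    rewrite E. ring.
  - field. auto.
Qed.

(* Otherwise [(x f)' > 0] below [X], against [X f(X) = 0]. *)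
Lemma convexity_numerator_nonpos (mu alpha X : R) :
  -1 < mu -> 0 <= alpha -> 0 < X -> bfun mu X = 0 ->
  (forall x, 0 <= x < X -> 0 < bfun mu x) ->
  exists b, 0 < b < X /\ b * bfun' mu b + (1 - alpha) * bfun mu b <= 0.
Proof.
  intros Hmu Hal HX HX0 Hpos. assert (Hr := regular_gt mu Hmu).
  destruct (MVT_cor2 (fun x => x * bfun mu x) (fun x => x * bfun' mu x + bfun mu x) 0 X) as [c [Hc1 Hc2]]; auto.
  - intros c _. apply is_derive_Reals. evar_last.
    + apply (is_derive_mult (fun x => x) (bfun mu)).
      * apply is_derive_id.
      * now apply is_derive_bfun.
      * intros; apply Rmult_comm.
    + unfold plus, mult, one; simpl. ring.
  - exists c. split; auto. rewrite HX0 in Hc1.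
    assert (Hz : c * bfun' mu c + bfun mu c = 0).
    { apply Rmult_eq_reg_r with (X - 0); [|lra]. rewrite <- Hc1. ring. }
    (* At [c] the numerator equals [- alpha * f(c)]. *)
    assert (0 < bfun mu c) by (apply Hpos; lra). nra.
Qed.

(** The radius is measured in [z] and the zero [j] in the square root of [z], hence the bound by
    [j ^ 2]. For [nu = 0] and [alpha = 0] the root is the square of the first zero of [J_0], about
    5.78, while [j] is about 3.83. At [nu = -1] the factor [Gamma (nu + 1)] has a pole. *)
Theorem theorem7 :
  forall nu alpha : R,
    -2 < nu -> nu <> -1 -> 0 <= alpha < 1 ->
    exists r j : R,
      radius_of_convexity alpha (phi nu) = Finite r /\
      smallest_positive (convexity_equation nu alpha) r /\
      smallest_positive (fun x : R => BesselJ (nu + 1) (RtoC x) = RtoC 0) j /\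
      r < j ^ 2.
Proof.
  intros nu alpha H2 H1 Hal.
  assert (Hmu : -1 < nu + 1) by lra.
  assert (Hr : regular nu) by now apply regular_nu.
  assert (Hr1 := regular_gt _ Hmu).
  destruct (bfun_first_zero (nu + 1) Hmu) as [X [HX [HX0 Hpos]]].
  set (G := fun x => x * bfun' (nu + 1) x + (1 - alpha) * bfun (nu + 1) x).
  destruct (convexity_numerator_nonpos (nu + 1) alpha X) as [b [Hb HGb]]; auto; [lra|].
  destruct (first_zero G b) as [r [Hrb [HGr HGpos]]].
  - intros x. apply continuity_pt_plus; apply continuity_pt_mult.
    + apply derivable_continuous_pt, derivable_pt_id.
    + now apply continuity_bfun'.
    + apply continuity_pt_const. intros u v. reflexivity.
    + now apply continuity_bfun.
  - lra.
  - unfold G. rewrite bfun_0. lra.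
  - exact HGb.
  - assert (Hj : 0 < sqrt X) by now apply sqrt_lt_R0.
    assert (Hj2 : sqrt X ^ 2 = X) by (apply pow2_sqrt; lra).
    exists r, (sqrt X). rewrite Hj2.
    split; [|split; [split; [lra|split]|split; [split; [lra|split]|lra]]].
    + apply is_lub_Rbar_unique. split.
      (* At [z = r] the quantity equals [alpha], so the strict inequality fails in every larger
         disk. *)
      * intros s [Hs Hconv]. simpl. apply Rnot_lt_le. intros Hlt.
        assert (Hfr : 0 < bfun (nu + 1) r) by (apply Hpos; lra).
        destruct (Hconv (RtoC r)) as [_ [_ [_ Hgt]]].
        { rewrite Cmod_R, Rabs_pos_eq; lra. }
        destruct (convexity_quotient nu (RtoC r)) as [_ Eq]; auto.
        { rewrite CPS_RtoC. intros E. apply RtoC_inj in E. fold (bfun (nu + 1) r) in E. lra. }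
        rewrite Eq, !CPS_RtoC in Hgt.
        fold (bfun (nu + 1) r) (bfun' (nu + 1) r) in Hgt.
        rewrite <- RtoC_mult, <- RtoC_div, <- RtoC_plus in Hgt by lra.
        change (1 + r * bfun' (nu + 1) r / bfun (nu + 1) r > alpha) in Hgt.
        unfold G in HGr.
        replace (r * bfun' (nu + 1) r) with (- ((1 - alpha) * bfun (nu + 1) r)) in Hgt by lra.
        replace (1 + - ((1 - alpha) * bfun (nu + 1) r) / bfun (nu + 1) r) with alpha in Hgt by (field; lra).
        lra.
      (* The disk is open, so [r] itself belongs to the set. *)
      * intros m Hm. apply Hm. split; [lra|]. intros z Hz.
        pose proof (Cmod_ge_0 z).
        assert (Hfz : 0 < bfun (nu + 1) (Cmod z)) by (apply Hpos; lra).
        destruct (convexity_quotient nu z) as [Hne Eq]; auto.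
        { apply (bcoef_neq_0_disk (nu + 1) X); auto; lra. }
        repeat split; auto.
        -- apply (ex_derive_ext (CPS (bcoef nu))).
           { intros t. symmetry. now apply phi_CPS. }
           eexists. apply is_derive_CPS, bcoef_entire, Hr.
        -- rewrite C_derive_phi by auto. eexists. apply is_derive_CPS, entire_derive, bcoef_entire, Hr.
        -- rewrite Eq.
           change (1 + Re (z * CPS (PS_derive (bcoef (nu + 1))) z / CPS (bcoef (nu + 1)) z)%C > alpha).
           pose proof (Re_log_derivative_ge (nu + 1) X z Hmu Hpos ltac:(lra)) as Hge.
           pose proof (HGpos (Cmod z) ltac:(lra)) as HG. unfold G in HG.
           assert (alpha - 1 < Cmod z * bfun' (nu + 1) (Cmod z) / bfun (nu + 1) (Cmod z)); [|lra].
           apply Rmult_lt_reg_r with (bfun (nu + 1) (Cmod z)); auto.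
           unfold Rdiv. rewrite Rmult_assoc, Rinv_l by lra. lra.
    + apply convexity_equation_iff; auto; try lra. assert (0 < bfun (nu + 1) r) by (apply Hpos; lra). lra.
    + intros y Hy Heq. assert (0 < bfun (nu + 1) y) by (apply Hpos; lra).
      apply convexity_equation_iff in Heq; auto; try lra.
      pose proof (HGpos y ltac:(lra)) as HG. unfold G in HG. lra.
    + apply BesselJ_pos_zero_iff; auto. now rewrite Hj2.
    + intros y Hy Hz. apply BesselJ_pos_zero_iff in Hz; [|auto|lra].
      assert (Hy2 : y ^ 2 < X) by (rewrite <- Hj2; simpl; nra).
      pose proof (Hpos (y ^ 2) (conj (pow2_ge_0 y) Hy2)). lra.
Qed.
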